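(* The homogeneous $4$-Pythagoras number of binary octics satisfies $p_4(2,8)\in\{3,4\}$.
   Context: $\Sigma^4_{2,8}\subset\mathbb{R}[x,y]_8$ is the cone of real binary octics that are finite sums of fourth powers of forms in $\mathbb{R}[x,y]_2$. $p_4(2,8)$ is the minimal $\ell$ such that every $f\in\Sigma^4_{2,8}$ can be written as a sum of at most $\ell$ fourth powers of real binary quadratic forms. *)

(* Defs.v *)
From Stdlib Require Import Reals List Arith.
Import ListNotations.
Open Scope R_scope.

Definition quad_form : Type := (R * R * R)%type.

Definition qeval (q : quad_form) (x y : R) : R :=
  let '(a, b, c) := q in a * x ^ 2 + b * x * y + c * y ^ 2.

Definition sum_fourth (l : list quad_form) (x y : R) : R :=
  fold_right (fun q acc => (qeval q x y) ^ 4 + acc) 0 l.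

(* f (a binary form, viewed as a polynomial function on R^2) equals the sum
   of fourth powers of the quadratic forms in l. Over R, equality of
   polynomials is equivalent to equality of the polynomial functions. *)
Definition represents (f : R -> R -> R) (l : list quad_form) : Prop :=
  forall x y : R, f x y = sum_fourth l x y.

(* The cone Sigma^4_{2,8}: finite sums of fourth powers of real binary
   quadratic forms (these are automatically binary octic forms). *)
Definition in_Sigma4_2_8 (f : R -> R -> R) : Prop :=
  exists l : list quad_form, represents f l.

Definition p4_bound (ell : nat) : Prop :=
  forall f, in_Sigma4_2_8 f ->
    exists l : list quad_form, (length l <= ell)%nat /\ represents f l.

Definition is_p4_2_8 (p : nat) : Prop :=
  p4_bound p /\ forall ell, p4_bound ell -> (p <= ell)%nat.

(* Main.v *)
Require Import Defs.
From Stdlib Require Import Reals List Arith.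
From Stdlib Require Import Lra Lia Permutation Classical ClassicalEpsilon.
Import ListNotations.
Open Scope R_scope.

(** Upper bound. Given f in the cone, minimise, over tuples (q_i) with f' = sum q_i^4, the
    quantity |f' - f|^2 - s * sum disc(q_i)^2 for small s > 0. By convexity the minimiser
    carries a dual certificate: a nonnegative ternary quartic P(q) = L(q^4) - disc(q)^2,
    L linear on octics, vanishing at every q_i. Because of the term -disc^2, P is never the
    square of a quadratic form. A nonnegative ternary quartic with five zeros in P^2, no three
    of them collinear, is such a square; hence either P has at most four zeros, or P vanishes on
    a line. In the second case P has at most one zero off the line (otherwise P is the
    square of a product of two linear forms), and the q_i on the line contribute a sum of
    fourth powers of binary linear forms, for which three terms suffice by Gauss
    quadrature. So f' is a sum of four fourth powers; f' tends to f as s tends to 0, and the set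
    of such sums is closed.

    Lower bound. If x^4 (x^4 + y^4 + (x + y)^4) = q_1^4 + q_2^4, then x divides both q_i,
    so the quartic factor is a sum of two fourth powers of linear forms, contradicting the
    nonsingularity of its 3 x 3 Hankel matrix. *)

(** * Finite sums over lists *)

Definition lsum {A : Type} (phi : A -> R) (l : list A) : R :=
  fold_right (fun q acc => phi q + acc) 0 l.

Lemma lsum_cons {A} (phi : A -> R) a l : lsum phi (a :: l) = phi a + lsum phi l.
Proof. reflexivity. Qed.

Lemma lsum_app {A} (phi : A -> R) l1 l2 :
  lsum phi (l1 ++ l2) = lsum phi l1 + lsum phi l2.
Proof. induction l1 as [|a l1 IH]; simpl; [|rewrite IH]; lra. Qed.

Lemma lsum_perm {A} (phi : A -> R) l1 l2 :
  Permutation l1 l2 -> lsum phi l1 = lsum phi l2.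
Proof. induction 1; simpl; lra. Qed.

Lemma lsum_map {A B} (phi : B -> R) (g : A -> B) l :
  lsum phi (map g l) = lsum (fun a => phi (g a)) l.
Proof. induction l as [|a l IH]; simpl; [|rewrite IH]; reflexivity. Qed.

Lemma lsum_ext {A} (phi psi : A -> R) l :
  (forall a, In a l -> phi a = psi a) -> lsum phi l = lsum psi l.
Proof.
  induction l as [|a l IH]; simpl; intros H; [reflexivity|].
  rewrite H, IH; auto.
Qed.

Lemma lsum_plus {A} (phi psi : A -> R) l :
  lsum (fun a => phi a + psi a) l = lsum phi l + lsum psi l.
Proof. induction l as [|a l IH]; simpl; [|rewrite IH]; lra. Qed.

Lemma lsum_scal {A} c (phi : A -> R) l :
  lsum (fun a => c * phi a) l = c * lsum phi l.
Proof. induction l as [|a l IH]; simpl; [|rewrite IH]; lra. Qed.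

Lemma lsum_le {A} (phi psi : A -> R) l :
  (forall a, In a l -> phi a <= psi a) -> lsum phi l <= lsum psi l.
Proof.
  induction l as [|a l IH]; simpl; intros H; [lra|].
  apply Rplus_le_compat; auto.
Qed.

Lemma lsum_nonneg {A} (phi : A -> R) l :
  (forall a, In a l -> 0 <= phi a) -> 0 <= lsum phi l.
Proof.
  induction l as [|a l IH]; simpl; intros H; [lra|].
  apply Rplus_le_le_0_compat; auto.
Qed.

Lemma lsum_ge_term {A} (phi : A -> R) l a :
  (forall b, In b l -> 0 <= phi b) -> In a l -> phi a <= lsum phi l.
Proof.
  induction l as [|b l IH]; simpl; intros H [].
  - subst. assert (0 <= lsum phi l) by (apply lsum_nonneg; auto). lra.
  - assert (phi a <= lsum phi l) by auto. assert (0 <= phi b) by auto. lra.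
Qed.

Lemma lsum_swap {A B} (phi : A -> B -> R) l m :
  lsum (fun a => lsum (fun b => phi a b) m) l = lsum (fun b => lsum (fun a => phi a b) l) m.
Proof.
  induction l as [|a l IH]; simpl.
  - induction m; simpl; lra.
  - rewrite IH, lsum_plus. reflexivity.
Qed.

Lemma lsum_zero_terms {A} (phi : A -> R) l :
  (forall b, In b l -> 0 <= phi b) -> lsum phi l = 0 -> forall a, In a l -> phi a = 0.
Proof.
  intros H E a Ha. pose proof (lsum_ge_term phi l a H Ha). specialize (H a Ha). lra.
Qed.

(** * Convex reduction *)

Lemma in_permutation_cons {A} (a : A) l : In a l -> exists l', Permutation (a :: l') l.
Proof.
  intros H. destruct (in_split _ _ H) as (l1 & l2 & ->).
  exists (l1 ++ l2). apply Permutation_middle.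
Qed.

(** Gaussian elimination, by induction on the number of functionals. The relation is a list of
    weighted elements lying over a permutation of [l], so repeated elements keep separate
    weights. *)
Lemma linear_dependence {A} (phis : list (A -> R)) : forall l : list A,
  (length phis < length l)%nat ->
  exists w : list (R * A), Permutation (map snd w) l /\
    (exists p, In p w /\ fst p <> 0) /\
    forall phi, In phi phis -> lsum (fun p => fst p * phi (snd p)) w = 0.
Proof.
  remember (length phis) as n eqn:Hn. revert phis Hn.
  induction n as [|n IH]; intros [|phi phis] Hn l Hl; try discriminate.
  - destruct l as [|a l]; simpl in Hl; [lia|].
    exists (map (fun x => (1, x)) (a :: l)). split; [|split].
    + rewrite map_map; simpl. rewrite map_id. reflexivity.
    + exists (1, a). simpl. split; [auto|lra].
    + intros phi [].
  - simpl in Hn. injection Hn as Hn.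
    destruct (classic (exists a, In a l /\ phi a <> 0)) as [(a & Ha & Hp)|Hz].
    + destruct (in_permutation_cons _ _ Ha) as [l' Hl'].
      (* [adj psi] vanishes at [a], so the weight of [a] does not affect it; that weight is then
         chosen to annihilate [phi]. *)
      pose (adj := fun (psi : A -> R) x => psi x - psi a / phi a * phi x).
      destruct (IH (map adj phis)) with (l := l') as (w & Hw & (p & Hpw & Hp0) & Hall).
      * rewrite length_map; auto.
      * apply Permutation_length in Hl'. simpl in Hl'. lia.
      * exists ((- lsum (fun p => fst p * phi (snd p)) w / phi a, a) :: w).
        split; [|split].
        -- simpl. rewrite <- Hl'. constructor; auto.
        -- exists p; simpl; auto.
        -- intros psi [<-|Hpsi]; rewrite lsum_cons; simpl.
           ++ field; auto.
           ++ specialize (Hall (adj psi) (in_map adj _ _ Hpsi)).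
              unfold adj in Hall.
              rewrite (lsum_ext _ (fun p => fst p * psi (snd p) +
                 (- (psi a / phi a)) * (fst p * phi (snd p)))) in Hall
                by (intros; ring).
              rewrite lsum_plus, lsum_scal in Hall.
              rewrite <- Hall. field; auto.
    + destruct (IH phis Hn l) as (w & Hw & Hex & Hall); [simpl in Hl; lia|].
      exists w. split; [auto|split; [auto|]].
      intros psi [<-|Hpsi]; auto.
      assert (Hs : forall p, In p w -> phi (snd p) = 0).
      { intros p Hpw. destruct (Req_dec (phi (snd p)) 0) as [E|E]; auto.
        exfalso. apply Hz. exists (snd p). split; auto.
        apply (Permutation_in _ Hw), in_map; auto. }
      rewrite (lsum_ext _ (fun p => 0 * fst p)) by (intros p Hpw; rewrite Hs by auto; ring).
      rewrite lsum_scal. ring.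
Qed.

Definition qscale (t : R) (q : quad_form) : quad_form :=
  let '(a, b, c) := q in (t * a, t * b, t * c).

Definition homog4 (phi : quad_form -> R) : Prop :=
  forall t q, phi (qscale t q) = t ^ 4 * phi q.

Definition root4 (w : R) : R := sqrt (sqrt w).

Lemma root4_pow w : 0 <= w -> root4 w ^ 4 = w.
Proof.
  intros H. unfold root4. pose proof (sqrt_pos w).
  replace (sqrt (sqrt w) ^ 4) with ((sqrt (sqrt w) * sqrt (sqrt w)) * (sqrt (sqrt w) * sqrt (sqrt w))) by ring.
  rewrite !sqrt_sqrt; auto.
Qed.

Lemma exists_max {A} (phi : A -> R) (l : list A) :
  l <> [] -> exists a, In a l /\ forall b, In b l -> phi b <= phi a.
Proof.
  induction l as [|a l IH]; intros H; [congruence|].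
  destruct l as [|a' l].
  - exists a. split; [now left|]. intros b [<-|[]]; lra.
  - destruct IH as (m & Hm & Hmax); [discriminate|].
    destruct (Rle_dec (phi a) (phi m)).
    + exists m. split; [now right|]. intros b [<-|Hb]; auto.
    + exists a. split; [now left|]. intros b [<-|Hb]; [lra|].
      specialize (Hmax b Hb). lra.
Qed.

(** Given a relation, each form is reweighted by [1 - fst p / fst m], where [m] carries the largest
    weight. These factors are nonnegative and the one at [m] is zero, so that form drops out;
    homogeneity of degree four absorbs the other factors as fourth roots. *)
Lemma caratheodory_step (phis : list (quad_form -> R)) (l : list quad_form) :
  (forall phi, In phi phis -> homog4 phi) ->
  (length phis < length l)%nat ->
  exists l', S (length l') = length l /\
    forall phi, In phi phis -> lsum phi l' = lsum phi l.
Proof.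
  intros Hh Hlen.
  assert (Hpos : exists w : list (R * quad_form), Permutation (map snd w) l /\
    (exists p, In p w /\ 0 < fst p) /\
    forall phi, In phi phis -> lsum (fun p => fst p * phi (snd p)) w = 0).
  { destruct (linear_dependence phis l Hlen) as (w & Hw & (p & Hp & Hp0) & Hall).
    destruct (Rlt_dec 0 (fst p)).
    - exists w. eauto.
    - exists (map (fun p => (- fst p, snd p)) w). split; [|split].
      + rewrite map_map; simpl. auto.
      + exists (- fst p, snd p). split; [|simpl; lra].
        apply (in_map (fun p => (- fst p, snd p))); auto.
      + intros phi Hphi. rewrite lsum_map; simpl.
        rewrite (lsum_ext _ (fun p => (-1) * (fst p * phi (snd p)))) by (intros; ring).
        rewrite lsum_scal, Hall by auto. ring. }
  destruct Hpos as (w & Hw & (p & Hp & Hp0) & Hall).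
  destruct (exists_max fst w) as (m & Hm & Hmax).
  { intros ->; contradiction. }
  assert (Hm0 : 0 < fst m) by (specialize (Hmax p Hp); lra).
  destruct (in_permutation_cons _ _ Hm) as [w' Hw'].
  exists (map (fun p => qscale (root4 (1 - fst p / fst m)) (snd p)) w'). split.
  - rewrite length_map. apply Permutation_length in Hw, Hw'.
    rewrite length_map in Hw. simpl in Hw'. lia.
  - intros phi Hphi. rewrite <- (lsum_perm _ _ _ Hw), !lsum_map.
    assert (E : lsum (fun p => (1 - fst p / fst m) * phi (snd p)) w
                = lsum (fun p => phi (snd p)) w).
    { rewrite (lsum_ext _ (fun p => phi (snd p) + (- / fst m) * (fst p * phi (snd p))))
        by (intros; field; lra).
      rewrite lsum_plus, lsum_scal, Hall by auto. ring. }
    rewrite <- E, <- (lsum_perm _ _ _ Hw'), lsum_cons.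
    rewrite (lsum_ext _ (fun p => (1 - fst p / fst m) * phi (snd p))).
    + field; lra.
    + intros p' Hp'. rewrite (Hh phi Hphi), root4_pow; auto.
      assert (Hin : In p' w) by (eapply Permutation_in; [apply Hw'|now right]).
      specialize (Hmax p' Hin).
      assert (fst p' / fst m <= 1); [|lra].
      apply Rmult_le_reg_r with (fst m); auto. field_simplify; lra.
Qed.

(** * Minimisation on finite-dimensional spaces *)

Lemma functional_choice {A B} (P : A -> B -> Prop) :
  (forall a, exists b, P a b) -> exists f, forall a, P a (f a).
Proof.
  intros H. exists (fun a => proj1_sig (constructive_indefinite_description _ (H a))).
  intros a. apply proj2_sig.
Qed.

(** Beyond each index [n] there is a term within 1/(n+1) of a Bolzano-Weierstrass cluster point. The
    reindexing [sg] need not be increasing: [n <= sg n] is enough to preserve limits. *)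
Lemma bounded_cluster (u : nat -> R) (B : R) :
  (forall n, Rabs (u n) <= B) ->
  exists (sg : nat -> nat) (l : R), (forall n, (n <= sg n)%nat) /\ Un_cv (fun n => u (sg n)) l.
Proof.
  intros H.
  destruct (Bolzano_Weierstrass u (fun x => - B <= x <= B)) as [l Hl].
  { apply compact_P3. }
  { intros n. specialize (H n). unfold Rabs in H. destruct Rcase_abs; lra. }
  assert (Hc : forall n, exists p, (n <= p)%nat /\ Rabs (u p - l) < / INR (S n)).
  { intros n.
    assert (Hn : 0 < / INR (S n)) by (apply Rinv_0_lt_compat, lt_0_INR; lia).
    destruct (Hl (disc l (mkposreal _ Hn)) n) as (p & Hp1 & Hp2).
    - exists (mkposreal _ Hn). intros x Hx; exact Hx.
    - exists p. split; auto. }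
  destruct (functional_choice _ Hc) as [sg Hsg].
  exists sg, l. split; [intros n; apply Hsg|].
  intros eps He.
  destruct (archimed_cor1 eps He) as (N & HN & HN0).
  exists N. intros n Hn. unfold Rdist.
  destruct (Hsg n) as [_ Hs]. eapply Rlt_trans; [apply Hs|].
  eapply Rle_lt_trans; [|apply HN].
  apply Rinv_le_contravar; [apply lt_0_INR; lia|apply le_INR; lia].
Qed.

Lemma cv_reindex u l sg : (forall n, (n <= sg n)%nat) -> Un_cv u l -> Un_cv (fun n => u (sg n)) l.
Proof.
  intros Hs Hu eps He. destruct (Hu eps He) as [N HN]. exists N.
  intros n Hn. apply HN. specialize (Hs n). lia.
Qed.

Lemma bounded_cluster_vec (B : R) (k : nat) : forall (u : nat -> nat -> R),
  (forall n i, (i < k)%nat -> Rabs (u n i) <= B) ->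
  exists (sg : nat -> nat) (y : nat -> R), (forall n, (n <= sg n)%nat) /\
    forall i, (i < k)%nat -> Un_cv (fun n => u (sg n) i) (y i).
Proof.
  induction k as [|k IH]; intros u H.
  - exists (fun n => n), (fun _ => 0). split; intros; lia.
  - destruct (IH u) as (sg & y & Hs & Hy); [intros; apply H; lia|].
    destruct (bounded_cluster (fun n => u (sg n) k) B) as (tau & l & Ht & Hl);
      [intros; apply H; lia|].
    exists (fun n => sg (tau n)), (fun i => if Nat.eqb i k then l else y i). split.
    + intros n. specialize (Ht n). specialize (Hs (tau n)). lia.
    + intros i Hi. destruct (Nat.eqb_spec i k) as [->|Hne]; auto.
      apply (cv_reindex (fun n => u (sg n) i)); auto. apply Hy. lia.
Qed.

(** Continuity is asked along convergence of the first [k] coordinates only, which also says that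
    [F] depends on nothing else. A minimising sequence stays in a bounded sublevel set, hence
    clusters, and the cluster point is a minimiser. *)
Lemma coercive_min (F : (nat -> R) -> R) (k : nat) (lo B : R) :
  (forall u y, (forall i, (i < k)%nat -> Un_cv (fun n => u n i) (y i)) ->
    Un_cv (fun n => F (u n)) (F y)) ->
  (forall x, lo <= F x) ->
  (forall x, F x <= F (fun _ => 0) + 1 -> forall i, (i < k)%nat -> Rabs (x i) <= B) ->
  exists y, forall x, F y <= F x.
Proof.
  intros Hc Hlo Hb.
  (* [m] is the supremum of [- F], so the infimum of [F] is [- m]. *)
  destruct (completeness (fun r => exists x, r = - F x)) as [m [Hm1 Hm2]].
  { exists (- lo). intros r [x ->]. specialize (Hlo x). lra. }
  { exists (- F (fun _ => 0)). eauto. }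
  assert (Hseq : forall n, exists x, F x < - m + / INR (S n)).
  { intros n. apply NNPP. intros Hn.
    assert (Hi : 0 < / INR (S n)) by (apply Rinv_0_lt_compat, lt_0_INR; lia).
    assert (m <= m - / INR (S n)); [|lra].
    apply Hm2. intros r [x ->].
    destruct (Rlt_dec (F x) (- m + / INR (S n))); [exfalso; eauto|lra]. }
  destruct (functional_choice _ Hseq) as [u Hu].
  assert (Hle : forall x, - m <= F x).
  { intros x. specialize (Hm1 (- F x) (ex_intro _ x eq_refl)). lra. }
  destruct (bounded_cluster_vec B k u) as (sg & y & Hs & Hy).
  { intros n i Hi. apply Hb; auto.
    specialize (Hu n). specialize (Hle (fun _ => 0)).
    assert (/ INR (S n) <= 1); [|lra].
    rewrite <- Rinv_1. apply Rinv_le_contravar; [lra|].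
    rewrite S_INR. pose proof (pos_INR n). lra. }
  exists y. intros x.
  assert (F y <= - m); [|specialize (Hle x); lra].
  apply Rnot_lt_le. intros Hlt.
  destruct (Hc (fun n => u (sg n)) y Hy ((F y + m) / 2)) as [N HN]; [lra|].
  destruct (archimed_cor1 ((F y + m) / 2)) as (N' & HN' & HN0); [lra|].
  specialize (HN (max N N') ltac:(lia)). unfold Rdist in HN.
  apply Rabs_def2 in HN.
  specialize (Hu (sg (max N N'))). specialize (Hs (max N N')).
  assert (/ INR (S (sg (max N N'))) <= / INR N'); [|lra].
  apply Rinv_le_contravar; [apply lt_0_INR; lia|apply le_INR; lia].
Qed.

Lemma pow2_pos x : x <> 0 -> 0 < x ^ 2.
Proof. intros H. pose proof (Rsqr_pos_lt x H). unfold Rsqr in *. lra. Qed.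

(** * Ternary quartics *)

Definition is_lin3 (F : R -> R -> R -> R) : Prop :=
  exists u v w, forall x y z, F x y z = u * x + v * y + w * z.

Definition quad3 (a b c d e g x y z : R) : R :=
  a * x ^ 2 + b * y ^ 2 + c * z ^ 2 + d * x * y + e * x * z + g * y * z.

Definition is_quad3 (F : R -> R -> R -> R) : Prop :=
  exists a b c d e g, forall x y z, F x y z = quad3 a b c d e g x y z.

Definition quartic3 (c400 c310 c301 c220 c211 c202 c130 c121 c112 c103 c040 c031 c022 c013 c004
    x y z : R) : R :=
  c400 * x ^ 4 + c310 * x ^ 3 * y + c301 * x ^ 3 * z
  + c220 * x ^ 2 * y ^ 2 + c211 * x ^ 2 * y * z + c202 * x ^ 2 * z ^ 2
  + c130 * x * y ^ 3 + c121 * x * y ^ 2 * z + c112 * x * y * z ^ 2 + c103 * x * z ^ 3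
  + c040 * y ^ 4 + c031 * y ^ 3 * z + c022 * y ^ 2 * z ^ 2 + c013 * y * z ^ 3 + c004 * z ^ 4.

Definition is_quartic3 (F : R -> R -> R -> R) : Prop :=
  exists c400 c310 c301 c220 c211 c202 c130 c121 c112 c103 c040 c031 c022 c013 c004,
  forall x y z, F x y z =
    quartic3 c400 c310 c301 c220 c211 c202 c130 c121 c112 c103 c040 c031 c022 c013 c004 x y z.

Lemma is_quad3_mul F G : is_lin3 F -> is_lin3 G -> is_quad3 (fun x y z => F x y z * G x y z).
Proof.
  intros (u & v & w & HF) (u' & v' & w' & HG).
  exists (u * u'), (v * v'), (w * w'), (u * v' + v * u'), (u * w' + w * u'), (v * w' + w * v').
  intros. rewrite HF, HG. unfold quad3. ring.
Qed.

Lemma is_quad3_comb s t F G : is_quad3 F -> is_quad3 G ->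
  is_quad3 (fun x y z => s * F x y z + t * G x y z).
Proof.
  intros (a & b & c & d & e & g & HF) (a' & b' & c' & d' & e' & g' & HG).
  exists (s * a + t * a'), (s * b + t * b'), (s * c + t * c'),
    (s * d + t * d'), (s * e + t * e'), (s * g + t * g').
  intros. rewrite HF, HG. unfold quad3. ring.
Qed.

Lemma is_quartic3_sqr F : is_quad3 F -> is_quartic3 (fun x y z => F x y z ^ 2).
Proof.
  intros (a & b & c & d & e & g & HF).
  exists (a * a), (2 * a * d), (2 * a * e), (d * d + 2 * a * b), (2 * a * g + 2 * d * e),
    (e * e + 2 * a * c), (2 * b * d), (2 * b * e + 2 * d * g), (2 * c * d + 2 * e * g),
    (2 * c * e), (b * b), (2 * b * g), (g * g + 2 * b * c), (2 * c * g), (c * c).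
  intros. rewrite HF. unfold quad3, quartic3. ring.
Qed.

Lemma is_quartic3_comb s t F G : is_quartic3 F -> is_quartic3 G ->
  is_quartic3 (fun x y z => s * F x y z + t * G x y z).
Proof.
  intros (a1 & a2 & a3 & a4 & a5 & a6 & a7 & a8 & a9 & a10 & a11 & a12 & a13 & a14 & a15 & HF)
    (b1 & b2 & b3 & b4 & b5 & b6 & b7 & b8 & b9 & b10 & b11 & b12 & b13 & b14 & b15 & HG).
  exists (s * a1 + t * b1), (s * a2 + t * b2), (s * a3 + t * b3), (s * a4 + t * b4),
    (s * a5 + t * b5), (s * a6 + t * b6), (s * a7 + t * b7), (s * a8 + t * b8),
    (s * a9 + t * b9), (s * a10 + t * b10), (s * a11 + t * b11), (s * a12 + t * b12),
    (s * a13 + t * b13), (s * a14 + t * b14), (s * a15 + t * b15).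
  intros. rewrite HF, HG. unfold quartic3. ring.
Qed.

Lemma is_quartic3_ext F G : (forall x y z, F x y z = G x y z) -> is_quartic3 F -> is_quartic3 G.
Proof.
  intros E (a1 & a2 & a3 & a4 & a5 & a6 & a7 & a8 & a9 & a10 & a11 & a12 & a13 & a14 & a15 & HF).
  exists a1, a2, a3, a4, a5, a6, a7, a8, a9, a10, a11, a12, a13, a14, a15.
  intros. rewrite <- E. apply HF.
Qed.

Lemma is_quad3_ext F G : (forall x y z, F x y z = G x y z) -> is_quad3 F -> is_quad3 G.
Proof.
  intros E (a & b & c & d & e & g & HF). exists a, b, c, d, e, g.
  intros. rewrite <- E. apply HF.
Qed.

Lemma is_quartic3_lsum {A} (F : A -> R -> R -> R -> R) (l : list A) :
  (forall a, In a l -> is_quartic3 (F a)) ->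
  is_quartic3 (fun x y z => lsum (fun a => F a x y z) l).
Proof.
  induction l as [|a l IH]; intros H; simpl.
  - exists 0, 0, 0, 0, 0, 0, 0, 0, 0, 0, 0, 0, 0, 0, 0. intros. unfold quartic3. ring.
  - eapply is_quartic3_ext; [|apply (is_quartic3_comb 1 1 (F a) (fun x y z => lsum (fun a => F a x y z) l))].
    + intros. simpl. ring.
    + apply H. now left.
    + apply IH. intros. apply H. now right.
Qed.

(** A ternary quartic has fifteen coefficients, and its values at the fifteen points below determine
    them. *)
Lemma quartic3_zero c400 c310 c301 c220 c211 c202 c130 c121 c112 c103 c040 c031 c022 c013 c004 :
  (forall x y z, quartic3 c400 c310 c301 c220 c211 c202 c130 c121 c112 c103 c040 c031 c022 c013 c004 x y z = 0) ->
  (c400 = 0 /\ c310 = 0 /\ c301 = 0 /\ c220 = 0 /\ c211 = 0 /\ c202 = 0 /\ c130 = 0) /\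
  (c121 = 0 /\ c112 = 0 /\ c103 = 0 /\ c040 = 0 /\ c031 = 0 /\ c022 = 0 /\ c013 = 0 /\ c004 = 0).
Proof.
  unfold quartic3. intros H.
  pose proof (H 1 0 0). pose proof (H 0 1 0). pose proof (H 0 0 1).
  pose proof (H 1 1 0). pose proof (H 1 (-1) 0). pose proof (H 1 2 0).
  pose proof (H 1 0 1). pose proof (H 1 0 (-1)). pose proof (H 1 0 2).
  pose proof (H 0 1 1). pose proof (H 0 1 (-1)). pose proof (H 0 1 2).
  pose proof (H 1 1 1). pose proof (H 1 1 (-1)). pose proof (H 1 (-1) 1).
  clear H.
  repeat split; lra.
Qed.

(** A nonnegative polynomial that vanishes at 0 has derivative zero there. This is the source of
    every double-zero argument below. *)
Lemma quartic1_vertex g0 g1 g2 g3 g4 :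
  (forall t, 0 <= g0 + g1 * t + g2 * t ^ 2 + g3 * t ^ 3 + g4 * t ^ 4) -> g0 = 0 -> g1 = 0.
Proof.
  intros H ->.
  destruct (Req_dec g1 0) as [E|E]; auto. exfalso.
  pose (K := Rabs g2 + Rabs g3 + Rabs g4).
  pose (m := 1 + K + Rabs g1).
  assert (HK : 0 <= K) by (unfold K; pose proof (Rabs_pos g2); pose proof (Rabs_pos g3); pose proof (Rabs_pos g4); lra).
  assert (H1 : 0 < Rabs g1) by (apply Rabs_pos_lt; auto).
  assert (Hm : 0 < m) by (unfold m; lra).
  (* With this [t] the linear term equals [- m * t ^ 2], and [m] is large enough to outweigh all
     higher terms. *)
  set (t := - g1 / m).
  assert (Ht : Rabs t < 1).
  { unfold t, Rdiv. rewrite Rabs_mult, Rabs_Ropp, Rabs_inv, (Rabs_right m) by lra.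
    apply Rmult_lt_reg_r with m; auto. rewrite Rmult_assoc, Rinv_l by lra. unfold m. lra. }
  assert (Ht2 : 0 < t ^ 2).
  { assert (t <> 0). { unfold t. intros C. apply E. apply Rmult_eq_compat_r with (r := m) in C.
      unfold Rdiv in C. rewrite Rmult_assoc, Rinv_l in C by lra. lra. }
    pose proof (pow2_pos t). auto. }
  specialize (H t).
  assert (Eg : g1 * t = - m * t ^ 2) by (unfold t; field; lra).
  assert (Hb : g2 + g3 * t + g4 * t ^ 2 <= K).
  { unfold K.
    assert (g2 <= Rabs g2) by apply Rle_abs.
    assert (g3 * t <= Rabs g3).
    { eapply Rle_trans; [apply Rle_abs|]. rewrite Rabs_mult. pose proof (Rabs_pos g3). nra. }
    assert (g4 * t ^ 2 <= Rabs g4).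
    { eapply Rle_trans; [apply Rle_abs|]. rewrite Rabs_mult, <- RPow_abs.
      pose proof (Rabs_pos g4). pose proof (Rabs_pos t).
      assert (Rabs t ^ 2 <= 1) by nra. nra. }
    lra. }
  assert (t ^ 2 * (g2 + g3 * t + g4 * t ^ 2) <= t ^ 2 * K) by (apply Rmult_le_compat_l; lra).
  assert (0 < t ^ 2 * (1 + Rabs g1)) by (apply Rmult_lt_0_compat; lra).
  assert (- m * t ^ 2 + t ^ 2 * K = - (t ^ 2 * (1 + Rabs g1))) by (unfold m; ring).
  nra.
Qed.

Lemma quartic3_vertex_x c400 c310 c301 c220 c211 c202 c130 c121 c112 c103 c040 c031 c022 c013 c004 :
  (forall x y z, 0 <= quartic3 c400 c310 c301 c220 c211 c202 c130 c121 c112 c103 c040 c031 c022 c013 c004 x y z) ->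
  c400 = 0 -> c310 = 0 /\ c301 = 0.
Proof.
  intros H E. split.
  - apply (quartic1_vertex c400 c310 c220 c130 c040); auto.
    intros t. specialize (H 1 t 0). unfold quartic3 in H. ring_simplify in H. lra.
  - apply (quartic1_vertex c400 c301 c202 c103 c004); auto.
    intros t. specialize (H 1 0 t). unfold quartic3 in H. ring_simplify in H. lra.
Qed.

(** The gradient of a semidefinite form vanishes at an isotropic vector, so the form is a multiple
    of the square of the linear form that vanishes at that vector. *)
Lemma psd_quad_isotropic B F C xi eta :
  (forall u v, 0 <= B * u ^ 2 + 2 * F * u * v + C * v ^ 2) ->
  xi <> 0 \/ eta <> 0 -> B * xi ^ 2 + 2 * F * xi * eta + C * eta ^ 2 = 0 ->
  exists m n, forall u v, B * u ^ 2 + 2 * F * u * v + C * v ^ 2 = (m * u + n * v) ^ 2.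
Proof.
  intros H Hne E.
  assert (H1 : 2 * (F * xi + C * eta) = 0).
  { apply (quartic1_vertex 0 _ C 0 0); auto. intros t. specialize (H xi (eta + t)). lra. }
  assert (H2 : 2 * (B * xi + F * eta) = 0).
  { apply (quartic1_vertex 0 _ B 0 0); auto. intros t. specialize (H (xi + t) eta). lra. }
  assert (HB : 0 <= B) by (specialize (H 1 0); lra).
  assert (HC : 0 <= C) by (specialize (H 0 1); lra).
  destruct Hne as [Hx|He].
  - exists (- (eta / xi) * sqrt C), (sqrt C). intros u v.
    replace ((- (eta / xi) * sqrt C * u + sqrt C * v) ^ 2)
      with ((sqrt C * sqrt C) * (v - eta / xi * u) ^ 2) by ring.
    rewrite sqrt_sqrt by auto.
    replace F with (- C * eta / xi) by (apply Rmult_eq_reg_r with xi; auto; field_simplify; lra).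
    replace B with (C * eta ^ 2 / xi ^ 2).
    + field; auto.
    + assert (EF : F = - C * eta / xi) by (apply Rmult_eq_reg_r with xi; auto; field_simplify; lra).
      assert (EB : B = - F * eta / xi) by (apply Rmult_eq_reg_r with xi; auto; field_simplify; lra).
      rewrite EB, EF. field; auto.
  - exists (sqrt B), (- (xi / eta) * sqrt B). intros u v.
    replace ((sqrt B * u + - (xi / eta) * sqrt B * v) ^ 2)
      with ((sqrt B * sqrt B) * (u - xi / eta * v) ^ 2) by ring.
    rewrite sqrt_sqrt by auto.
    assert (EF : F = - B * xi / eta) by (apply Rmult_eq_reg_r with eta; auto; field_simplify; lra).
    assert (EC : C = - F * xi / eta) by (apply Rmult_eq_reg_r with eta; auto; field_simplify; lra).
    rewrite EC, EF. field; auto.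
Qed.

(* The standard quadratic (Cremona) transformation (x:y:z) -> (yz:zx:xy) turns a quartic with double
   points at the three coordinate vertices into a conic; the conic below is singular
   at (1:1:1) and, by the fifth zero, a double line. *)
Lemma quartic3_five_zeros F p1 p2 p3 :
  is_quartic3 F -> (forall x y z, 0 <= F x y z) ->
  F 1 0 0 = 0 -> F 0 1 0 = 0 -> F 0 0 1 = 0 -> F 1 1 1 = 0 -> F p1 p2 p3 = 0 ->
  p1 <> 0 -> p2 <> 0 -> p3 <> 0 -> p1 <> p2 \/ p1 <> p3 ->
  exists h, is_quad3 h /\ forall x y z, F x y z = h x y z ^ 2.
Proof.
  intros (c400 & c310 & c301 & c220 & c211 & c202 & c130 & c121 & c112 & c103 & c040 & c031 & c022 & c013 & c004 & HF) Hp H1 H2 H3 H4 H5 P1 P2 P3 Hne.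
  rewrite HF in H1, H2, H3, H4, H5.
  assert (Hp' := Hp). setoid_rewrite HF in Hp'.
  assert (E400 : c400 = 0) by (unfold quartic3 in H1; lra).
  assert (E040 : c040 = 0) by (unfold quartic3 in H2; lra).
  assert (E004 : c004 = 0) by (unfold quartic3 in H3; lra).
  destruct (quartic3_vertex_x _ _ _ _ _ _ _ _ _ _ _ _ _ _ _ Hp' E400) as [E310 E301].
  assert (E2 : c130 = 0 /\ c031 = 0).
  { apply (quartic3_vertex_x c040 c130 c031 c220 c121 c022 c310 c211 c112 c013 c400 c301 c202 c103 c004); auto.
    intros x y z. specialize (Hp' y x z). unfold quartic3 in *. lra. }
  assert (E3 : c103 = 0 /\ c013 = 0).
  { apply (quartic3_vertex_x c004 c103 c013 c202 c112 c022 c301 c211 c121 c031 c400 c310 c220 c130 c040); auto.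
    intros x y z. specialize (Hp' y z x). unfold quartic3 in *. lra. }
  destruct E2 as [E130 E031], E3 as [E103 E013]. subst.
  unfold quartic3 in *.
  (* [G1], [G2] and [G3] express that the gradient vanishes at the zero (1,1,1). *)
  assert (G1 : 2 * c220 + 2 * c211 + 2 * c202 + c121 + c112 = 0).
  { apply (quartic1_vertex (c220 + c211 + c202 + c121 + c112 + c022) _ (c220 + c211 + c202) 0 0); [|lra].
    intros t. specialize (Hp' (1 + t) 1 1). lra. }
  assert (G2 : 2 * c220 + 2 * c121 + 2 * c022 + c211 + c112 = 0).
  { apply (quartic1_vertex (c220 + c211 + c202 + c121 + c112 + c022) _ (c220 + c121 + c022) 0 0); [|lra].
    intros t. specialize (Hp' 1 (1 + t) 1). lra. }
  assert (G3 : 2 * c202 + 2 * c112 + 2 * c022 + c211 + c121 = 0).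
  { apply (quartic1_vertex (c220 + c211 + c202 + c121 + c112 + c022) _ (c202 + c112 + c022) 0 0); [|lra].
    intros t. specialize (Hp' 1 1 (1 + t)). lra. }
  assert (K1 : c211 = c022 - c220 - c202) by lra.
  assert (K2 : c121 = c202 - c220 - c022) by lra.
  assert (K3 : c112 = c220 - c202 - c022) by lra.
  (* The conic in yz, zx, xy is singular at (1,1,1), so it depends only on the differences yz - xy
     and zx - xy. *)
  assert (HQ : forall x y z, F x y z =
     c022 * (y * z - x * y) ^ 2 + 2 * (c112 / 2) * (y * z - x * y) * (z * x - x * y)
     + c202 * (z * x - x * y) ^ 2).
  { intros. rewrite HF, K1, K2, K3. field. }
  destruct (psd_quad_isotropic c022 (c112 / 2) c202 (p2 * p3 - p1 * p2) (p3 * p1 - p1 * p2))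
    as (m & n & Hmn).
  (* Semidefiniteness in [u], [v]: the point (Z+u, Z+v, Z) has positive coordinates for this large
     [Z], hence has a preimage under the transformation, where [F] is nonnegative. *)
  - intros u v. set (Z := 1 + Rabs u + Rabs v).
    assert (HZ : 0 < Z) by (unfold Z; pose proof (Rabs_pos u); pose proof (Rabs_pos v); lra).
    assert (HX : 0 < Z + u) by (unfold Z; pose proof (Rabs_pos v); pose proof (Rle_abs (- u)); rewrite Rabs_Ropp in *; lra).
    assert (HY : 0 < Z + v) by (unfold Z; pose proof (Rabs_pos u); pose proof (Rle_abs (- v)); rewrite Rabs_Ropp in *; lra).
    specialize (Hp ((Z + v) * Z) ((Z + u) * Z) ((Z + u) * (Z + v))).
    rewrite HQ in Hp.
    assert (Hpos : 0 < ((Z + u) * (Z + v) * Z) ^ 2)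
      by (apply pow_lt; repeat apply Rmult_lt_0_compat; auto).
    apply Rmult_le_reg_l with (((Z + u) * (Z + v) * Z) ^ 2); auto.
    rewrite Rmult_0_r. eapply Rle_trans; [apply Hp|]. right. ring.
  (* The fifth zero yields a nonzero isotropic vector because its coordinates are nonzero and not
     all equal. *)
  - destruct (Req_dec p3 p1) as [E|E].
    + right. replace (p3 * p1 - p1 * p2) with (p1 * (p3 - p2)) by ring.
      apply Rmult_integral_contrapositive_currified; [auto|lra].
    + left. replace (p2 * p3 - p1 * p2) with (p2 * (p3 - p1)) by ring.
      apply Rmult_integral_contrapositive_currified; [auto|lra].
  - rewrite <- HQ, HF. lra.
  - exists (fun x y z => m * (y * z - x * y) + n * (z * x - x * y)). split.
    + exists 0, 0, 0, (- m - n), n, m. intros. unfold quad3. ring.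
    + intros. rewrite HQ. apply Hmn.
Qed.

(** Vanishing on y = 0 and on z = 0 makes [F] divisible by yz. By nonnegativity the zeros along each
    plane are double, so [F] is divisible by the square of yz, which already has degree four. *)
Lemma quartic3_two_planes F :
  is_quartic3 F -> (forall x y z, 0 <= F x y z) ->
  (forall x z, F x 0 z = 0) -> (forall x y, F x y 0 = 0) ->
  exists c, 0 <= c /\ forall x y z, F x y z = c * (y * z) ^ 2.
Proof.
  intros (c400 & c310 & c301 & c220 & c211 & c202 & c130 & c121 & c112 & c103 & c040 & c031 & c022 & c013 & c004 & HF) Hp Hy Hz.
  setoid_rewrite HF in Hp. setoid_rewrite HF in Hy. setoid_rewrite HF in Hz.
  destruct (quartic3_zero c400 0 c301 0 0 c202 0 0 0 c103 0 0 0 0 c004) as [Z1 Z2].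
  { intros x y z. specialize (Hy x z). unfold quartic3 in *. lra. }
  destruct (quartic3_zero c400 c310 0 c220 0 0 c130 0 0 0 c040 0 0 0 0) as [Z3 Z4].
  { intros x y z. specialize (Hz x y). unfold quartic3 in *. lra. }
  decompose [and] Z1. decompose [and] Z2. decompose [and] Z3. decompose [and] Z4.
  clear Z1 Z2 Z3 Z4. subst. unfold quartic3 in *.
  assert (Hcy : forall x z, c211 * x ^ 2 * z + c112 * x * z ^ 2 + c013 * z ^ 3 = 0).
  { intros x z. apply (quartic1_vertex 0 _ (c121 * x * z + c022 * z ^ 2) (c031 * z) 0); auto.
    intros t. specialize (Hp x t z). lra. }
  assert (Hcz : forall x y, c211 * x ^ 2 * y + c121 * x * y ^ 2 + c031 * y ^ 3 = 0).
  { intros x y. apply (quartic1_vertex 0 _ (c112 * x * y + c022 * y ^ 2) (c013 * y) 0); auto.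
    intros t. specialize (Hp x y t). lra. }
  pose proof (Hcy 0 1). pose proof (Hcy 1 1). pose proof (Hcy (-1) 1).
  pose proof (Hcz 0 1). pose proof (Hcz 1 1). pose proof (Hcz (-1) 1).
  assert (c013 = 0) by lra. assert (c112 = 0) by lra. assert (c211 = 0) by lra.
  assert (c031 = 0) by lra. assert (c121 = 0) by lra. subst.
  exists c022. split.
  - specialize (Hp 0 1 1). lra.
  - intros. rewrite HF. unfold quartic3. ring.
Qed.

(** On the line z = 0 the two double zeros leave only the monomial x^2 y^2, and a third zero removes
    it. *)
Lemma quartic3_line F al be :
  is_quartic3 F -> (forall x y z, 0 <= F x y z) ->
  F 1 0 0 = 0 -> F 0 1 0 = 0 -> al <> 0 -> be <> 0 -> F al be 0 = 0 ->
  forall x y, F x y 0 = 0.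
Proof.
  intros (c400 & c310 & c301 & c220 & c211 & c202 & c130 & c121 & c112 & c103 & c040 & c031 & c022 & c013 & c004 & HF) Hp H1 H2 Ha Hb H3 x y.
  rewrite HF in H1, H2, H3 |- *. setoid_rewrite HF in Hp.
  assert (E400 : c400 = 0) by (unfold quartic3 in H1; lra).
  assert (E040 : c040 = 0) by (unfold quartic3 in H2; lra).
  destruct (quartic3_vertex_x _ _ _ _ _ _ _ _ _ _ _ _ _ _ _ Hp E400) as [E310 _].
  assert (E2 : c130 = 0 /\ c031 = 0).
  { apply (quartic3_vertex_x c040 c130 c031 c220 c121 c022 c310 c211 c112 c013 c400 c301 c202 c103 c004); auto.
    intros u v w. specialize (Hp v u w). unfold quartic3 in *. lra. }
  destruct E2 as [E130 _]. subst. unfold quartic3 in *.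
  assert (c220 = 0); [|subst; ring].
  apply Rmult_eq_reg_r with (al ^ 2 * be ^ 2); [lra|].
  apply Rmult_integral_contrapositive_currified; apply pow_nonzero; auto.
Qed.

(** * Binary quartics *)

(* Two-point Gauss quadrature: the nodes are the roots of the orthogonal
   polynomial of degree 2, and the excess in the fourth moment is its squared norm. *)
Lemma gauss_two_nodes w1 w2 w3 x1 x2 x3 :
  0 < w1 -> 0 < w2 -> 0 < w3 -> x1 <> x2 -> x1 <> x3 -> x2 <> x3 ->
  exists A B C y1 y2, 0 <= A /\ 0 <= B /\ 0 <= C /\ forall U V,
    w1 * (x1 * U + V) ^ 4 + w2 * (x2 * U + V) ^ 4 + w3 * (x3 * U + V) ^ 4
    = A * (y1 * U + V) ^ 4 + B * (y2 * U + V) ^ 4 + C * U ^ 4.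
Proof.
  intros W1 W2 W3 N12 N13 N23.
  pose (m := fun k => w1 * x1 ^ k + w2 * x2 ^ k + w3 * x3 ^ k).
  set (D := m 0%nat * m 2%nat - m 1%nat ^ 2).
  assert (HD : D = w1 * w2 * (x1 - x2) ^ 2 + w1 * w3 * (x1 - x3) ^ 2 + w2 * w3 * (x2 - x3) ^ 2)
    by (unfold D, m; ring).
  assert (HD0 : 0 < D).
  { rewrite HD.
    assert (0 < (x1 - x2) ^ 2) by (apply pow2_pos; lra).
    assert (0 < (x1 - x3) ^ 2) by (apply pow2_pos; lra).
    assert (0 < (x2 - x3) ^ 2) by (apply pow2_pos; lra).
    assert (0 < w1 * w2) by nra. assert (0 < w1 * w3) by nra. assert (0 < w2 * w3) by nra.
    assert (0 < w1 * w2 * (x1 - x2) ^ 2) by (apply Rmult_lt_0_compat; auto).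
    assert (0 < w1 * w3 * (x1 - x3) ^ 2) by (apply Rmult_lt_0_compat; auto).
    assert (0 < w2 * w3 * (x2 - x3) ^ 2) by (apply Rmult_lt_0_compat; auto).
    lra. }
  (* x^2 + p x + r is the monic polynomial orthogonal to 1 and x for the three-point measure; [D] is
     the determinant of the linear system for [p] and [r]. *)
  set (p := (m 1%nat * m 2%nat - m 0%nat * m 3%nat) / D).
  set (r := (m 1%nat * m 3%nat - m 2%nat ^ 2) / D).
  assert (O1 : m 2%nat + p * m 1%nat + r * m 0%nat = 0) by (unfold p, r; unfold D in *; field; lra).
  assert (O2 : m 3%nat + p * m 2%nat + r * m 1%nat = 0) by (unfold p, r; unfold D in *; field; lra).
  clearbody p r. unfold m in *. clear D HD HD0 m.
  (* Otherwise the orthogonal polynomial is nonnegative with mean zero, hence vanishes at three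
     distinct nodes. *)
  assert (Hdisc : 0 < p ^ 2 - 4 * r).
  { apply Rnot_le_lt. intros Hle.
    assert (Hk : forall x, 0 <= x ^ 2 + p * x + r) by (intros x; pose proof (pow2_ge_0 (x + p / 2)); lra).
    assert (Hk1 := Hk x1). assert (Hk2 := Hk x2). assert (Hk3 := Hk x3).
    assert (E : w1 * (x1 ^ 2 + p * x1 + r) + w2 * (x2 ^ 2 + p * x2 + r) + w3 * (x3 ^ 2 + p * x3 + r) = 0) by lra.
    assert (0 <= w1 * (x1 ^ 2 + p * x1 + r)) by (apply Rmult_le_pos; lra).
    assert (0 <= w2 * (x2 ^ 2 + p * x2 + r)) by (apply Rmult_le_pos; lra).
    assert (0 <= w3 * (x3 ^ 2 + p * x3 + r)) by (apply Rmult_le_pos; lra).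
    assert (Z1 : x1 ^ 2 + p * x1 + r = 0) by (apply Rmult_eq_reg_l with w1; lra).
    assert (Z2 : x2 ^ 2 + p * x2 + r = 0) by (apply Rmult_eq_reg_l with w2; lra).
    assert (Z3 : x3 ^ 2 + p * x3 + r = 0) by (apply Rmult_eq_reg_l with w3; lra).
    assert (x1 + x2 + p = 0) by (apply Rmult_eq_reg_l with (x1 - x2); lra).
    assert (x1 + x3 + p = 0) by (apply Rmult_eq_reg_l with (x1 - x3); lra).
    lra. }
  set (e := sqrt (p ^ 2 - 4 * r)).
  assert (He : 0 < e) by (apply sqrt_lt_R0; auto).
  assert (He2 : e * e = p ^ 2 - 4 * r) by (apply sqrt_sqrt; lra).
  clearbody e.
  set (y1 := (- p - e) / 2). set (y2 := (- p + e) / 2).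
  assert (Ep : p = - (y1 + y2)) by (unfold y1, y2; field).
  assert (Er : r = y1 * y2) by (unfold y1, y2; replace r with ((p ^ 2 - e * e) / 4) by (rewrite He2; field); field).
  assert (Hlt : y1 < y2) by (unfold y1, y2; lra).
  clearbody y1 y2. clear e He He2 Hdisc. subst p r.
  (* [A] and [B] are the integrals of the squared Lagrange polynomials at the new nodes, so they are
     nonnegative. [EA] and [EB] below identify them, by orthogonality, with the integrals of the
     Lagrange polynomials themselves. *)
  set (A := (w1 * (x1 - y2) ^ 2 + w2 * (x2 - y2) ^ 2 + w3 * (x3 - y2) ^ 2) / (y2 - y1) ^ 2).
  set (B := (w1 * (x1 - y1) ^ 2 + w2 * (x2 - y1) ^ 2 + w3 * (x3 - y1) ^ 2) / (y2 - y1) ^ 2).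
  set (k := fun x => (x - y1) * (x - y2)).
  set (C := w1 * k x1 ^ 2 + w2 * k x2 ^ 2 + w3 * k x3 ^ 2).
  assert (Hsq : 0 < (y2 - y1) ^ 2) by (apply pow_lt; lra).
  exists A, B, C, y1, y2.
  assert (Hn : forall a b c, 0 <= w1 * a ^ 2 + w2 * b ^ 2 + w3 * c ^ 2).
  { intros a b c. pose proof (pow2_ge_0 a). pose proof (pow2_ge_0 b). pose proof (pow2_ge_0 c).
    assert (0 <= w1 * a ^ 2) by (apply Rmult_le_pos; lra).
    assert (0 <= w2 * b ^ 2) by (apply Rmult_le_pos; lra).
    assert (0 <= w3 * c ^ 2) by (apply Rmult_le_pos; lra). lra. }
  split; [apply Rmult_le_pos; [apply Hn|left; apply Rinv_0_lt_compat; auto]|].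
  split; [apply Rmult_le_pos; [apply Hn|left; apply Rinv_0_lt_compat; auto]|].
  split; [apply Hn|].
  assert (EA : A = (w1 * (y2 - x1) + w2 * (y2 - x2) + w3 * (y2 - x3)) / (y2 - y1)).
  { apply Rmult_eq_reg_r with ((y2 - y1) ^ 2); [|lra].
    transitivity (w1 * (x1 - y2) ^ 2 + w2 * (x2 - y2) ^ 2 + w3 * (x3 - y2) ^ 2);
      [unfold A; field; lra|].
    transitivity ((w1 * (y2 - x1) + w2 * (y2 - x2) + w3 * (y2 - x3)) * (y2 - y1)); [lra|field; lra]. }
  assert (EB : B = (w1 * (x1 - y1) + w2 * (x2 - y1) + w3 * (x3 - y1)) / (y2 - y1)).
  { apply Rmult_eq_reg_r with ((y2 - y1) ^ 2); [|lra].
    transitivity (w1 * (x1 - y1) ^ 2 + w2 * (x2 - y1) ^ 2 + w3 * (x3 - y1) ^ 2);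
      [unfold B; field; lra|].
    transitivity ((w1 * (x1 - y1) + w2 * (x2 - y1) + w3 * (x3 - y1)) * (y2 - y1)); [lra|field; lra]. }
  pose (m0 := w1 + w2 + w3).
  pose (m1 := w1 * x1 + w2 * x2 + w3 * x3).
  pose (m2 := w1 * x1 ^ 2 + w2 * x2 ^ 2 + w3 * x3 ^ 2).
  pose (m3 := w1 * x1 ^ 3 + w2 * x2 ^ 3 + w3 * x3 ^ 3).
  assert (M0 : A + B = m0) by (rewrite EA, EB; unfold m0; field; lra).
  assert (M1 : A * y1 + B * y2 = m1) by (rewrite EA, EB; unfold m1; field; lra).
  assert (M2 : A * y1 ^ 2 + B * y2 ^ 2 = m2).
  { transitivity ((y1 + y2) * (A * y1 + B * y2) - y1 * y2 * (A + B)); [ring|].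
    rewrite M0, M1. unfold m0, m1, m2. lra. }
  assert (M3 : A * y1 ^ 3 + B * y2 ^ 3 = m3).
  { transitivity ((y1 + y2) * (A * y1 ^ 2 + B * y2 ^ 2) - y1 * y2 * (A * y1 + B * y2)); [ring|].
    rewrite M1, M2. unfold m1, m2, m3. lra. }
  assert (M4 : A * y1 ^ 4 + B * y2 ^ 4 + C = w1 * x1 ^ 4 + w2 * x2 ^ 4 + w3 * x3 ^ 4).
  { transitivity ((y1 + y2) * (A * y1 ^ 3 + B * y2 ^ 3) - y1 * y2 * (A * y1 ^ 2 + B * y2 ^ 2) + C); [ring|].
    rewrite M3, M2.
    (* [k] is orthogonal to its own terms of degree at most one, so its squared norm [C] equals the
       integral of x^2 k. *)
    assert (O3 : - (y1 + y2) * (m3 + - (y1 + y2) * m2 + y1 * y2 * m1) + y1 * y2 * (m2 + - (y1 + y2) * m1 + y1 * y2 * m0) = 0)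
      by (replace (m3 + - (y1 + y2) * m2 + y1 * y2 * m1) with 0 by (unfold m1, m2, m3; lra);
          replace (m2 + - (y1 + y2) * m1 + y1 * y2 * m0) with 0 by (unfold m0, m1, m2; lra); ring).
    unfold C, k. unfold m0, m1, m2, m3 in *. lra. }
  intros U V.
  transitivity ((w1 * x1 ^ 4 + w2 * x2 ^ 4 + w3 * x3 ^ 4) * U ^ 4 + 4 * m3 * U ^ 3 * V + 6 * m2 * U ^ 2 * V ^ 2
     + 4 * m1 * U * V ^ 3 + m0 * V ^ 4).
  { unfold m0, m1, m2, m3. ring. }
  rewrite <- M4, <- M3, <- M2, <- M1, <- M0. ring.
Qed.

(** * The dual certificate *)

Definition qval (z : R) (q : quad_form) : R := qeval q 1 z.

Definition qdisc (q : quad_form) : R := let '(a, b, c) := q in b ^ 2 - 4 * a * c.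

(* A binary octic is determined by its values at the nine points (1 : z). *)
Definition nodes : list R := [-4; -3; -2; -1; 0; 1; 2; 3; 4].

(** The quartic P of the dual certificate. The linear functional L is encoded by weights [lam] on
    the nine values that determine an octic. *)
Definition certificate (lam : R -> R) (q : quad_form) : R :=
  lsum (fun z => lam z * qval z q ^ 4) nodes - qdisc q ^ 2.

Definition qadd (q r : quad_form) : quad_form :=
  let '(a, b, c) := q in let '(a', b', c') := r in (a + a', b + b', c + c').

Definition qcomb (x y z : R) (q r s : quad_form) : quad_form :=
  qadd (qscale x q) (qadd (qscale y r) (qscale z s)).

Lemma certificate_homog4 lam : homog4 (certificate lam).
Proof.
  intros t [[a b] c]. unfold certificate, qval, qdisc, nodes, lsum, qscale, qeval; simpl. ring.
Qed.

Lemma certificate_is_quartic3 lam q r s :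
  is_quartic3 (fun x y z => certificate lam (qcomb x y z q r s)).
Proof.
  set (V := fun w x y z => qval w (qcomb x y z q r s)).
  destruct q as [[a b] c], r as [[a' b'] c'], s as [[a'' b''] c''].
  assert (Hv : forall w, is_lin3 (V w)).
  { intros w. exists (qval w (a, b, c)), (qval w (a', b', c')), (qval w (a'', b'', c'')).
    intros. unfold V, qval, qcomb, qadd, qscale, qeval. ring. }
  (* Each fourth power is written as the square of a product of linear forms; the factors 1 and 0
     only give the expression the shape of [is_quartic3_comb]. *)
  apply (is_quartic3_ext (fun x y z =>
    1 * lsum (fun w => lam w * (V w x y z * V w x y z) ^ 2 + 0 * (V w x y z * V w x y z) ^ 2) nodes
    + (-1) * qdisc (qcomb x y z (a, b, c) (a', b', c') (a'', b'', c'')) ^ 2)).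
  { intros. unfold certificate.
    rewrite (lsum_ext _ (fun w => lam w * V w x y z ^ 4)) by (intros; ring).
    unfold V. ring. }
  apply is_quartic3_comb.
  - apply (is_quartic3_lsum (fun w x y z =>
      lam w * (V w x y z * V w x y z) ^ 2 + 0 * (V w x y z * V w x y z) ^ 2)).
    intros w _. apply is_quartic3_comb; apply is_quartic3_sqr, is_quad3_mul; apply Hv.
  - apply is_quartic3_sqr.
    apply (is_quad3_ext (fun x y z =>
      1 * ((x * b + y * b' + z * b'') * (x * b + y * b' + z * b''))
      + (-4) * ((x * a + y * a' + z * a'') * (x * c + y * c' + z * c'')))).
    { intros. unfold qdisc, qcomb, qadd, qscale. ring. }
    apply is_quad3_comb; apply is_quad3_mul.
    + exists b, b', b''; intros; ring.
    + exists b, b', b''; intros; ring.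
    + exists a, a', a''; intros; ring.
    + exists c, c', c''; intros; ring.
Qed.

(* Writing certificate = h^2, the coefficients of h satisfy the six relations
   characterising, up to qdisc^2, the quartics of the form q |-> L(q^4); these
   relations have no real solution. *)
Lemma certificate_not_square lam h :
  is_quad3 h -> (forall a b c, certificate lam (a, b, c) = h a b c ^ 2) -> False.
Proof.
  intros (A & B & C & D & E & G & Hh) H.
  (* [l k] is the value of L on x^(8-k) y^k. [Z] collects the coefficients of the certificate minus
     h^2. *)
  pose (l := fun k => lsum (fun z => lam z * z ^ k) nodes).
  assert (Z : forall a b c, quartic3 (l 0%nat - A ^ 2) (4 * l 1%nat - 2 * A * D) (4 * l 2%nat - 2 * A * E)
     (6 * l 2%nat - (D ^ 2 + 2 * A * B)) (12 * l 3%nat - (2 * A * G + 2 * D * E))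
     (6 * l 4%nat - 16 - (E ^ 2 + 2 * A * C)) (4 * l 3%nat - 2 * B * D)
     (12 * l 4%nat + 8 - (2 * B * E + 2 * D * G)) (12 * l 5%nat - (2 * C * D + 2 * E * G))
     (4 * l 6%nat - 2 * C * E) (l 4%nat - 1 - B ^ 2) (4 * l 5%nat - 2 * B * G)
     (6 * l 6%nat - (G ^ 2 + 2 * B * C)) (4 * l 7%nat - 2 * C * G) (l 8%nat - C ^ 2) a b c = 0).
  { intros a b c. apply Rminus_diag_eq with (r1 := certificate lam (a, b, c)) in H as H'.
    rewrite Hh in H'. rewrite <- H'.
    unfold certificate, l, lsum, nodes, qval, qeval, qdisc, quartic3, quad3; simpl. ring. }
  apply quartic3_zero in Z. destruct Z as [Z1 Z2].
  decompose [and] Z1. decompose [and] Z2. clear Z1 Z2.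
  (* The moments [l 2] to [l 6] each occur in several coefficients; eliminating them gives [R1] to
     [R6]. The constants 10 come from the squared discriminant. *)
  assert (R1 : D * D = A * (3 * E - 2 * B)) by lra.
  assert (R2 : G * G = C * (3 * E - 2 * B)) by lra.
  assert (R3 : A * G = D * (3 * B - E)) by lra.
  assert (R4 : C * D = G * (3 * B - E)) by lra.
  assert (R5 : B * E + D * G = 6 * B ^ 2 + 10) by lra.
  assert (R6 : E ^ 2 + 2 * A * C = 6 * B ^ 2 - 10) by lra.
  assert (Hno : A = 0 \/ C = 0 -> D * G = 0 -> False).
  { intros HAC HDG. assert (E ^ 2 = 6 * B ^ 2 - 10) by (destruct HAC; subst; lra).
    assert (EB : B * E = 6 * B ^ 2 + 10) by lra.
    assert (EB2 : (B * E) ^ 2 = B ^ 2 * (6 * B ^ 2 - 10)) by (rewrite Rpow_mult_distr; nra).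
    rewrite EB in EB2. pose proof (pow2_ge_0 B). nra. }
  assert (Hno' : D * G = 0 -> 3 * E - 2 * B = 0 -> False).
  { intros HDG HE. assert (EE : E = 2 * B / 3) by lra. subst E.
    pose proof (pow2_ge_0 B). nra. }
  destruct (Req_dec D 0) as [HD|HD].
  { assert (HDG : D * G = 0) by (subst; ring).
    assert (HZ : A * (3 * E - 2 * B) = 0) by (subst; lra).
    destruct (Rmult_integral _ _ HZ); eauto. }
  destruct (Req_dec G 0) as [HG|HG].
  { assert (HDG : D * G = 0) by (subst; ring).
    assert (HZ : C * (3 * E - 2 * B) = 0) by (subst; lra).
    destruct (Rmult_integral _ _ HZ); eauto. }
  assert (HA : A <> 0).
  { intros ->. apply HD. assert (HZ : D * D = 0) by lra. destruct (Rmult_integral _ _ HZ); auto. }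
  assert (U : D * G = (3 * E - 2 * B) * (3 * B - E)).
  { apply Rmult_eq_reg_l with A; auto.
    transitivity (D * (A * G)); [ring|]. rewrite R3.
    transitivity (D * D * (3 * B - E)); [ring|]. rewrite R1. ring. }
  (* Substituting [U] into [R5] gives -3 (E - 2B)^2 = 10. *)
  pose proof (pow2_ge_0 (E - 2 * B)). nra.
Qed.

(** * Linear algebra in the space of quadratic forms *)

Definition dot (n q : quad_form) : R :=
  let '(a, b, c) := n in let '(a', b', c') := q in a * a' + b * b' + c * c'.

Definition cross (q r : quad_form) : quad_form :=
  let '(a, b, c) := q in let '(a', b', c') := r in
  (b * c' - c * b', c * a' - a * c', a * b' - b * a').

Definition det (q r s : quad_form) : R := dot (cross q r) s.

Definition qzero : quad_form := (0, 0, 0).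

Ltac qsolve :=
  unfold det, qcomb, cross, dot, qadd, qscale, qzero in *; simpl in *.

Lemma neq_qzero a b c : (a, b, c) <> qzero -> a <> 0 \/ b <> 0 \/ c <> 0.
Proof.
  intros H. destruct (Req_dec a 0), (Req_dec b 0), (Req_dec c 0); auto.
  subst. exfalso. apply H. reflexivity.
Qed.

Lemma triple_eq (a b c a' b' c' : R) : a = a' -> b = b' -> c = c' -> (a, b, c) = (a', b', c').
Proof. intros; subst; reflexivity. Qed.

Lemma dot_self_pos n : n <> qzero -> 0 < dot n n.
Proof.
  destruct n as [[a b] c]. intros H. apply neq_qzero in H. qsolve.
  pose proof (pow2_ge_0 a). pose proof (pow2_ge_0 b). pose proof (pow2_ge_0 c).
  destruct H as [H|[H|H]]; apply pow2_pos in H; lra.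
Qed.

(** Cramer's rule on a nonzero 2 x 2 minor. The last argument [u] of [qcomb] is a placeholder with
    coefficient 0. *)
Lemma coplanar_comb u v q : cross u v <> qzero -> det u v q = 0 ->
  exists al be, q = qcomb al be 0 u v u.
Proof.
  destruct u as [[u1 u2] u3], v as [[v1 v2] v3], q as [[q1 q2] q3].
  intros H E. apply neq_qzero in H. qsolve.
  destruct H as [H|[H|H]].
  - exists ((q2 * v3 - q3 * v2) / (u2 * v3 - u3 * v2)), ((u2 * q3 - u3 * q2) / (u2 * v3 - u3 * v2)).
    apply triple_eq; try (field; auto).
    apply Rmult_eq_reg_l with (u2 * v3 - u3 * v2); auto. field_simplify; auto. lra.
  - exists ((q3 * v1 - q1 * v3) / (u3 * v1 - u1 * v3)), ((u3 * q1 - u1 * q3) / (u3 * v1 - u1 * v3)).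
    apply triple_eq; try (field; auto).
    apply Rmult_eq_reg_l with (u3 * v1 - u1 * v3); auto. field_simplify; auto. lra.
  - exists ((q1 * v2 - q2 * v1) / (u1 * v2 - u2 * v1)), ((u1 * q2 - u2 * q1) / (u1 * v2 - u2 * v1)).
    apply triple_eq; try (field; auto).
    apply Rmult_eq_reg_l with (u1 * v2 - u2 * v1); auto. field_simplify; auto. lra.
Qed.

Lemma cramer u v w q : det u v w <> 0 ->
  q = qcomb (det q v w / det u v w) (det u q w / det u v w) (det u v q / det u v w) u v w.
Proof.
  destruct u as [[u1 u2] u3], v as [[v1 v2] v3], w as [[w1 w2] w3], q as [[q1 q2] q3].
  intros H. qsolve. apply triple_eq; field; auto.
Qed.

Lemma cross_zero_scale q r : q <> qzero -> cross q r = qzero -> exists t, r = qscale t q.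
Proof.
  destruct q as [[a b] c], r as [[a' b'] c']. intros H E. apply neq_qzero in H. qsolve.
  injection E as E1 E2 E3.
  destruct H as [H|[H|H]].
  - exists (a' / a). apply triple_eq; [field; auto| |];
      apply Rmult_eq_reg_l with a; auto; field_simplify; auto; lra.
  - exists (b' / b). apply triple_eq; [|field; auto|];
      apply Rmult_eq_reg_l with b; auto; field_simplify; auto; lra.
  - exists (c' / c). apply triple_eq; [| |field; auto];
      apply Rmult_eq_reg_l with c; auto; field_simplify; auto; lra.
Qed.

Lemma det_zero_of_common_normal n u v q :
  n <> qzero -> dot n u = 0 -> dot n v = 0 -> dot n q = 0 -> det u v q = 0.
Proof.
  destruct n as [[n1 n2] n3], u as [[u1 u2] u3], v as [[v1 v2] v3], q as [[q1 q2] q3].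
  intros H E1 E2 E3. apply neq_qzero in H. unfold det, cross, dot in *.
  destruct H as [H|[H|H]].
  - apply Rmult_eq_reg_l with n1; auto. rewrite Rmult_0_r.
    transitivity ((n1 * u1 + n2 * u2 + n3 * u3) * (v2 * q3 - v3 * q2)
      + (n1 * v1 + n2 * v2 + n3 * v3) * (q2 * u3 - q3 * u2)
      + (n1 * q1 + n2 * q2 + n3 * q3) * (u2 * v3 - u3 * v2)); [ring|].
    rewrite E1, E2, E3. ring.
  - apply Rmult_eq_reg_l with n2; auto. rewrite Rmult_0_r.
    transitivity ((n1 * u1 + n2 * u2 + n3 * u3) * (v3 * q1 - v1 * q3)
      + (n1 * v1 + n2 * v2 + n3 * v3) * (q3 * u1 - q1 * u3)
      + (n1 * q1 + n2 * q2 + n3 * q3) * (u3 * v1 - u1 * v3)); [ring|].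
    rewrite E1, E2, E3. ring.
  - apply Rmult_eq_reg_l with n3; auto. rewrite Rmult_0_r.
    transitivity ((n1 * u1 + n2 * u2 + n3 * u3) * (v1 * q2 - v2 * q1)
      + (n1 * v1 + n2 * v2 + n3 * v3) * (q1 * u2 - q2 * u1)
      + (n1 * q1 + n2 * q2 + n3 * q3) * (u1 * v2 - u2 * v1)); [ring|].
    rewrite E1, E2, E3. ring.
Qed.

Lemma is_lin3_det1 u v : is_lin3 (fun a b c => det (a, b, c) u v).
Proof.
  destruct u as [[u1 u2] u3], v as [[v1 v2] v3].
  exists (u2 * v3 - u3 * v2), (u3 * v1 - u1 * v3), (u1 * v2 - u2 * v1).
  intros. qsolve. ring.
Qed.

Lemma is_lin3_scal t F : is_lin3 F -> is_lin3 (fun x y z => F x y z / t).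
Proof.
  intros (u & v & w & H). exists (u / t), (v / t), (w / t). intros. rewrite H. unfold Rdiv. ring.
Qed.

Lemma is_lin3_ext F G : (forall x y z, F x y z = G x y z) -> is_lin3 F -> is_lin3 G.
Proof. intros E (u & v & w & H). exists u, v, w. intros. rewrite <- E. auto. Qed.

Lemma is_quad3_subst h X Y Z : is_quad3 h -> is_lin3 X -> is_lin3 Y -> is_lin3 Z ->
  is_quad3 (fun a b c => h (X a b c) (Y a b c) (Z a b c)).
Proof.
  intros (a & b & c & d & e & g & H) HX HY HZ.
  apply (is_quad3_ext (fun x y z =>
    1 * (1 * (a * (X x y z * X x y z) + b * (Y x y z * Y x y z))
      + 1 * (c * (Z x y z * Z x y z) + d * (X x y z * Y x y z)))
      + 1 * (e * (X x y z * Z x y z) + g * (Y x y z * Z x y z)))).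
  - intros. rewrite H. unfold quad3. ring.
  - repeat apply is_quad3_comb; apply is_quad3_mul; auto.
Qed.

(** Cramer's rule turns a square in the coordinates of a basis into a square in the standard
    coordinates, which [certificate_not_square] excludes. *)
Lemma square_in_basis lam u v w h : det u v w <> 0 -> is_quad3 h ->
  (forall x y z, certificate lam (qcomb x y z u v w) = h x y z ^ 2) -> False.
Proof.
  intros Hd Hh H.
  apply (certificate_not_square lam (fun a b c =>
    h (det (a, b, c) v w / det u v w) (det u (a, b, c) w / det u v w) (det u v (a, b, c) / det u v w))).
  - apply is_quad3_subst; auto; apply is_lin3_scal.
    + apply is_lin3_det1.
    + apply (is_lin3_ext (fun a b c => det (a, b, c) w u)); [|apply is_lin3_det1].
      intros. destruct u as [[? ?] ?], w as [[? ?] ?]. qsolve. ring.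
    + apply (is_lin3_ext (fun a b c => det (a, b, c) u v)); [|apply is_lin3_det1].
      intros. destruct u as [[? ?] ?], v as [[? ?] ?]. qsolve. ring.
  - intros a b c. rewrite <- H, <- cramer; auto.
Qed.

(** * Zeros of a nonnegative certificate *)

Definition psd_certificate (lam : R -> R) : Prop := forall q, 0 <= certificate lam q.

Lemma qcomb_vertex1 u v w : qcomb 1 0 0 u v w = u.
Proof. destruct u as [[? ?] ?], v as [[? ?] ?], w as [[? ?] ?]. qsolve. apply triple_eq; ring. Qed.

Lemma qcomb_vertex2 u v w : qcomb 0 1 0 u v w = v.
Proof. destruct u as [[? ?] ?], v as [[? ?] ?], w as [[? ?] ?]. qsolve. apply triple_eq; ring. Qed.

Lemma qcomb_vertex3 u v w : qcomb 0 0 1 u v w = w.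
Proof. destruct u as [[? ?] ?], v as [[? ?] ?], w as [[? ?] ?]. qsolve. apply triple_eq; ring. Qed.

Lemma certificate_line lam u v al be :
  psd_certificate lam -> certificate lam u = 0 -> certificate lam v = 0 ->
  al <> 0 -> be <> 0 -> certificate lam (qcomb al be 0 u v u) = 0 ->
  forall x y, certificate lam (qcomb x y 0 u v u) = 0.
Proof.
  intros Hp Hu Hv Ha Hb H x y.
  apply (quartic3_line (fun x y z => certificate lam (qcomb x y z u v u)) al be); auto.
  - apply certificate_is_quartic3.
  - rewrite (f_equal (certificate lam) (qcomb_vertex1 u v u)); auto.
  - rewrite (f_equal (certificate lam) (qcomb_vertex2 u v u)); auto.
Qed.

Lemma cross_comb_l u v al be w : cross u (qcomb al be 0 u v w) = qscale be (cross u v).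
Proof.
  destruct u as [[? ?] ?], v as [[? ?] ?], w as [[? ?] ?]. qsolve. apply triple_eq; ring.
Qed.

Lemma cross_comb_r u v al be w : cross v (qcomb al be 0 u v w) = qscale (- al) (cross u v).
Proof.
  destruct u as [[? ?] ?], v as [[? ?] ?], w as [[? ?] ?]. qsolve. apply triple_eq; ring.
Qed.

Lemma qscale_0 q : qscale 0 q = qzero.
Proof. destruct q as [[? ?] ?]. qsolve. apply triple_eq; ring. Qed.

(** Pairwise independence makes both coefficients of [q] in terms of [u] and [v] nonzero, so these
    are three distinct zeros on one projective line, and the certificate vanishes on that whole
    line. *)
Lemma coplanar_zeros lam u v q :
  psd_certificate lam ->
  certificate lam u = 0 -> certificate lam v = 0 -> certificate lam q = 0 ->
  cross u v <> qzero -> cross u q <> qzero -> cross v q <> qzero -> det u v q = 0 ->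
  exists n, n <> qzero /\ forall r, dot n r = 0 -> certificate lam r = 0.
Proof.
  intros Hp Hu Hv Hq Nuv Nuq Nvq Hd. exists (cross u v). split; auto.
  intros r Hr.
  destruct (coplanar_comb u v q Nuv Hd) as (al & be & E).
  destruct (coplanar_comb u v r Nuv Hr) as (x & y & ->).
  apply certificate_line with al be; auto; try congruence.
  - intros ->. apply Nvq. rewrite E, cross_comb_r, Ropp_0, qscale_0. reflexivity.
  - intros ->. apply Nuq. rewrite E, cross_comb_l, qscale_0. reflexivity.
Qed.

(** If [u] and [v] were independent, the projective line through them would meet the given line in a
    third zero [w]. The certificate would vanish on both lines and so be a square. *)
Lemma zeros_off_plane lam n u v :
  psd_certificate lam -> n <> qzero ->
  (forall r, dot n r = 0 -> certificate lam r = 0) ->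
  certificate lam u = 0 -> certificate lam v = 0 -> dot n u <> 0 -> dot n v <> 0 ->
  cross u v = qzero.
Proof.
  intros Hp Hn Hpl Hu Hv Nu Nv. apply NNPP. intros Nuv.
  set (w := qcomb (dot n v) (- dot n u) 0 u v u).
  assert (Ew : dot n w = 0).
  { unfold w. destruct n as [[? ?] ?], u as [[? ?] ?], v as [[? ?] ?]. qsolve. ring. }
  assert (Hw : certificate lam w = 0) by auto.
  assert (Hline : forall x y, certificate lam (qcomb x y 0 u v u) = 0).
  { apply certificate_line with (dot n v) (- dot n u); auto. lra. }
  assert (Nw : w <> qzero).
  { intros C. apply Nuv. assert (Cuw : cross u w = qzero).
    { rewrite C. destruct u as [[? ?] ?]. qsolve. apply triple_eq; ring. }
    unfold w in Cuw. rewrite cross_comb_l in Cuw.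
    destruct (cross u v) as [[a b] c]. qsolve. injection Cuw as E1 E2 E3.
    apply triple_eq; apply Rmult_eq_reg_l with (- dot n u); try lra;
      destruct n as [[? ?] ?], u as [[? ?] ?]; qsolve; lra. }
  (* In the basis [w], [u], [w'] the given plane is y = 0 and the plane spanned by [u] and [v] is z
     = 0. *)
  set (w' := cross n w).
  assert (Ew' : dot n w' = 0).
  { unfold w'. destruct n as [[? ?] ?], w as [[? ?] ?]. qsolve. ring. }
  assert (Hd : det w u w' <> 0).
  { assert (E : det w u w' = - (dot w w * dot n u) + dot n w * dot w u).
    { unfold w'. destruct n as [[? ?] ?], u as [[? ?] ?], w as [[? ?] ?]. qsolve. ring. }
    rewrite E, Ew. pose proof (dot_self_pos w Nw).
    intros C. apply Nu. apply Rmult_eq_reg_l with (dot w w); lra. }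
  destruct (quartic3_two_planes (fun x y z => certificate lam (qcomb x y z w u w')))
    as (c & Hc & HF).
  - apply certificate_is_quartic3.
  - auto.
  - intros x z. apply Hpl. transitivity (x * dot n w + z * dot n w').
    + destruct n as [[? ?] ?], u as [[? ?] ?], w as [[? ?] ?], w' as [[? ?] ?]. qsolve. ring.
    + rewrite Ew, Ew'. ring.
  - intros x y.
    transitivity (certificate lam (qcomb (x * dot n v + y) (- x * dot n u) 0 u v u)); [|auto].
    f_equal. unfold w. clearbody w'.
    destruct n as [[? ?] ?], u as [[? ?] ?], v as [[? ?] ?], w' as [[? ?] ?]. qsolve.
    apply triple_eq; ring.
  - apply (square_in_basis lam w u w' (fun x y z => sqrt c * (y * z))); auto.
    + exists 0, 0, 0, 0, 0, (sqrt c). intros. unfold quad3. ring.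
    + intros. rewrite HF. rewrite <- (sqrt_sqrt c Hc) at 1. ring.
Qed.

(** Phrased through permutations so that positions are compared rather than values: a list with a
    repeated form is dependent. *)
Definition pairwise_indep (l : list quad_form) : Prop :=
  forall q r l', Permutation (q :: r :: l') l -> cross q r <> qzero.

Lemma pairwise_indep_cons q l : pairwise_indep (q :: l) ->
  (forall r, In r l -> cross q r <> qzero) /\ pairwise_indep l.
Proof.
  intros H. split.
  - intros r Hr. destruct (in_permutation_cons _ _ Hr) as [l' Hl'].
    apply (H q r l'). constructor. auto.
  - intros q' r l' Hl'. apply (H q' r (q :: l')).
    rewrite <- Hl', (perm_swap q r), (perm_swap q q'). reflexivity.
Qed.

(** A coplanar triple gives the plane at once. If the seven triples tested below are all
    independent, the zeros can be moved to the coordinate vertices, (1:1:1) and a point with nonzero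
    coordinates; then the certificate is a square, which is impossible. *)
Lemma five_zeros_plane lam q1 q2 q3 q4 q5 :
  psd_certificate lam -> pairwise_indep [q1; q2; q3; q4; q5] ->
  (forall q, In q [q1; q2; q3; q4; q5] -> certificate lam q = 0) ->
  exists n, n <> qzero /\ forall r, dot n r = 0 -> certificate lam r = 0.
Proof.
  intros Hp Hi Hz.
  destruct (pairwise_indep_cons _ _ Hi) as [I1 Hi2].
  destruct (pairwise_indep_cons _ _ Hi2) as [I2 Hi3].
  destruct (pairwise_indep_cons _ _ Hi3) as [I3 Hi4].
  destruct (pairwise_indep_cons _ _ Hi4) as [I4 _].
  assert (Z1 := Hz q1 ltac:(simpl; auto)). assert (Z2 := Hz q2 ltac:(simpl; auto)).
  assert (Z3 := Hz q3 ltac:(simpl; auto)). assert (Z4 := Hz q4 ltac:(simpl; auto)).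
  assert (Z5 := Hz q5 ltac:(simpl; auto 6)).
  destruct (Req_dec (det q1 q2 q3) 0) as [E|D123];
    [apply (coplanar_zeros lam q1 q2 q3); simpl in *; auto|].
  destruct (Req_dec (det q1 q2 q4) 0) as [E|D124];
    [apply (coplanar_zeros lam q1 q2 q4); simpl in *; auto|].
  destruct (Req_dec (det q1 q3 q4) 0) as [E|D134];
    [apply (coplanar_zeros lam q1 q3 q4); simpl in *; auto|].
  destruct (Req_dec (det q2 q3 q4) 0) as [E|D234];
    [apply (coplanar_zeros lam q2 q3 q4); simpl in *; auto|].
  destruct (Req_dec (det q1 q2 q5) 0) as [E|D125];
    [apply (coplanar_zeros lam q1 q2 q5); simpl in *; auto 6|].
  destruct (Req_dec (det q1 q3 q5) 0) as [E|D135];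
    [apply (coplanar_zeros lam q1 q3 q5); simpl in *; auto 6|].
  destruct (Req_dec (det q2 q3 q5) 0) as [E|D235];
    [apply (coplanar_zeros lam q2 q3 q5); simpl in *; auto 6|].
  exfalso.
  assert (I45 : cross q4 q5 <> qzero) by (apply I4; simpl; auto).
  clear I1 I2 I3 I4 Hi Hi2 Hi3 Hi4 Hz.
  set (d := det q1 q2 q3) in *.
  set (al := det q4 q2 q3 / d). set (be := det q1 q4 q3 / d). set (ga := det q1 q2 q4 / d).
  assert (A0 : al <> 0).
  { unfold al, Rdiv. apply Rmult_integral_contrapositive_currified; [|apply Rinv_neq_0_compat; auto].
    intros C. apply D234. rewrite <- C.
    destruct q2 as [[? ?] ?], q3 as [[? ?] ?], q4 as [[? ?] ?]. qsolve. ring. }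
  assert (B0 : be <> 0).
  { unfold be, Rdiv. apply Rmult_integral_contrapositive_currified; [|apply Rinv_neq_0_compat; auto].
    intros C. apply D134. rewrite <- Ropp_0, <- C.
    destruct q1 as [[? ?] ?], q3 as [[? ?] ?], q4 as [[? ?] ?]. qsolve. ring. }
  assert (G0 : ga <> 0).
  { unfold ga, Rdiv. apply Rmult_integral_contrapositive_currified; [|apply Rinv_neq_0_compat; auto]. auto. }
  assert (E4 : q4 = qcomb al be ga q1 q2 q3) by (apply cramer; auto).
  (* Rescaling the basis vectors gives [q4] the coordinates (1,1,1). *)
  set (u := qscale al q1). set (v := qscale be q2). set (w := qscale ga q3).
  assert (E4' : q4 = qcomb 1 1 1 u v w).
  { rewrite E4. unfold u, v, w. clearbody al be ga.
    destruct q1 as [[? ?] ?], q2 as [[? ?] ?], q3 as [[? ?] ?]. qsolve. apply triple_eq; ring. }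
  assert (Ed : det u v w = al * be * ga * d).
  { unfold u, v, w, d. clearbody al be ga.
    destruct q1 as [[? ?] ?], q2 as [[? ?] ?], q3 as [[? ?] ?]. qsolve. ring. }
  assert (Nd : det u v w <> 0).
  { rewrite Ed. auto 6 using Rmult_integral_contrapositive_currified. }
  set (p1 := det q5 v w / det u v w). set (p2 := det u q5 w / det u v w).
  set (p3 := det u v q5 / det u v w).
  assert (E5 : q5 = qcomb p1 p2 p3 u v w) by (apply cramer; auto).
  assert (P1 : p1 <> 0).
  { unfold p1, Rdiv. apply Rmult_integral_contrapositive_currified; [|apply Rinv_neq_0_compat; auto].
    replace (det q5 v w) with (be * ga * det q2 q3 q5).
    - auto 6 using Rmult_integral_contrapositive_currified.
    - unfold v, w. clearbody be ga.
      clear. destruct q2 as [[? ?] ?], q3 as [[? ?] ?], q5 as [[? ?] ?]. qsolve. ring. }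
  assert (P2 : p2 <> 0).
  { unfold p2, Rdiv. apply Rmult_integral_contrapositive_currified; [|apply Rinv_neq_0_compat; auto].
    replace (det u q5 w) with (- al * ga * det q1 q3 q5).
    - auto 6 using Rmult_integral_contrapositive_currified, Ropp_neq_0_compat.
    - unfold u, w. clearbody al ga.
      clear. destruct q1 as [[? ?] ?], q3 as [[? ?] ?], q5 as [[? ?] ?]. qsolve. ring. }
  assert (P3 : p3 <> 0).
  { unfold p3, Rdiv. apply Rmult_integral_contrapositive_currified; [|apply Rinv_neq_0_compat; auto].
    replace (det u v q5) with (al * be * det q1 q2 q5).
    - auto 6 using Rmult_integral_contrapositive_currified.
    - unfold u, v. clearbody al be.
      clear. destruct q1 as [[? ?] ?], q2 as [[? ?] ?], q5 as [[? ?] ?]. qsolve. ring. }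
  assert (Zs : forall t q, certificate lam q = 0 -> certificate lam (qscale t q) = 0).
  { intros t q Hq. rewrite certificate_homog4, Hq. ring. }
  destruct (quartic3_five_zeros (fun x y z => certificate lam (qcomb x y z u v w)) p1 p2 p3)
    as (h & Hh & HF); auto.
  - apply certificate_is_quartic3.
  - rewrite qcomb_vertex1. apply Zs; auto.
  - rewrite qcomb_vertex2. apply Zs; auto.
  - rewrite qcomb_vertex3. apply Zs; auto.
  - rewrite <- E4'. auto.
  - rewrite <- E5. auto.
  (* Three equal coordinates would make [q5] a multiple of [q4]. *)
  - destruct (Req_dec p1 p2) as [E12|]; auto. destruct (Req_dec p1 p3) as [E13|]; auto.
    exfalso. apply I45. rewrite E4', E5, <- E12, <- E13.
    clear. clearbody u v w p1. destruct u as [[? ?] ?], v as [[? ?] ?], w as [[? ?] ?]. qsolve. apply triple_eq; ring.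
  - apply (square_in_basis lam u v w h); auto.
Qed.

(** * Shortening representations *)

Definition same_sum (l l' : list quad_form) : Prop :=
  forall x y, sum_fourth l x y = sum_fourth l' x y.

Lemma sum_fourth_lsum l x y : sum_fourth l x y = lsum (fun q => qeval q x y ^ 4) l.
Proof. reflexivity. Qed.

Lemma same_sum_perm l l' : Permutation l l' -> same_sum l l'.
Proof. intros H x y. rewrite !sum_fourth_lsum. apply lsum_perm; auto. Qed.

Lemma same_sum_trans l1 l2 l3 : same_sum l1 l2 -> same_sum l2 l3 -> same_sum l1 l3.
Proof. intros H1 H2 x y. rewrite H1. auto. Qed.

Lemma same_sum_cons q l l' : same_sum l l' -> same_sum (q :: l) (q :: l').
Proof. intros H x y. rewrite !sum_fourth_lsum, !lsum_cons, <- !sum_fourth_lsum, H. reflexivity. Qed.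

Definition scale_stable (S : quad_form -> Prop) : Prop := forall t q, S q -> S (qscale t q).

Lemma qeval_scale t q x y : qeval (qscale t q) x y = t * qeval q x y.
Proof. destruct q as [[a b] c]. unfold qeval, qscale. ring. Qed.

(** Fourth powers of proportional forms add up to a single fourth power. [S] will be a plane or the
    zero set of a certificate, so that the merged form stays in it. *)
Lemma merge_dependent (S : quad_form -> Prop) l :
  scale_stable S -> (forall q, In q l -> S q) -> ~ pairwise_indep l ->
  exists l', length l = Datatypes.S (length l') /\ (forall q, In q l' -> S q) /\ same_sum l l'.
Proof.
  intros HS Hl Hn. unfold pairwise_indep in Hn.
  apply not_all_ex_not in Hn as [q Hn]. apply not_all_ex_not in Hn as [r Hn].
  apply not_all_ex_not in Hn as [l' Hn]. apply imply_to_and in Hn as [Hperm Hc].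
  apply NNPP in Hc.
  assert (Hu : exists u, S u /\ forall x y, qeval q x y ^ 4 + qeval r x y ^ 4 = qeval u x y ^ 4).
  { assert (Sq : S q) by (apply Hl, (Permutation_in _ Hperm); simpl; auto).
    assert (Sr : S r) by (apply Hl, (Permutation_in _ Hperm); simpl; auto).
    destruct (classic (q = qzero)) as [->|Nq].
    - exists r. split; auto. intros. unfold qzero, qeval at 1. ring.
    - destruct (cross_zero_scale q r Nq Hc) as [t ->].
      assert (Ht : 0 <= 1 + t ^ 4) by (pose proof (pow2_ge_0 (t ^ 2)); lra).
      exists (qscale (root4 (1 + t ^ 4)) q). split; [apply HS; auto|].
      intros. rewrite !qeval_scale, (Rpow_mult_distr (root4 _)), root4_pow; auto. ring. }
  destruct Hu as (u & Su & Hu).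
  exists (u :: l'). split; [|split].
  - rewrite <- (Permutation_length Hperm). reflexivity.
  - intros s [<-|Hs]; auto. apply Hl, (Permutation_in _ Hperm). simpl; auto.
  - eapply same_sum_trans; [apply same_sum_perm; symmetry; apply Hperm|].
    intros x y. rewrite !sum_fourth_lsum, !lsum_cons, <- Hu. ring.
Qed.

(** With U = [q4] and V = [q1], the other two forms are multiples of x U + V. Two-node quadrature
    rewrites the fourth powers of [q1], [q2], [q3] as two such powers plus a multiple of U^4, which
    merges with the power of [q4]. *)
Lemma planar_four_to_three n q1 q2 q3 q4 :
  n <> qzero -> (forall q, In q [q1; q2; q3; q4] -> dot n q = 0) ->
  exists l, length l = 3%nat /\ (forall q, In q l -> dot n q = 0) /\ same_sum [q1; q2; q3; q4] l.
Proof.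
  intros Hn Hpl.
  destruct (classic (pairwise_indep [q1; q2; q3; q4])) as [Hi|Hi].
  2: { destruct (merge_dependent (fun q => dot n q = 0) [q1; q2; q3; q4]) as (l & Hlen & H1 & H2); auto.
       - intros t q Hq. transitivity (t * dot n q); [|rewrite Hq; ring].
         destruct n as [[? ?] ?], q as [[? ?] ?]. qsolve. ring.
       - exists l. simpl in Hlen. split; [lia|auto]. }
  destruct (pairwise_indep_cons _ _ Hi) as [I1 Hi2].
  destruct (pairwise_indep_cons _ _ Hi2) as [I2 Hi3].
  destruct (pairwise_indep_cons _ _ Hi3) as [I3 _].
  assert (D1 : dot n q1 = 0) by (apply Hpl; simpl; auto).
  assert (D2 : dot n q2 = 0) by (apply Hpl; simpl; auto).
  assert (D3 : dot n q3 = 0) by (apply Hpl; simpl; auto).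
  assert (D4 : dot n q4 = 0) by (apply Hpl; simpl; auto).
  assert (I14 : cross q1 q4 <> qzero) by (apply I1; simpl; auto).
  destruct (coplanar_comb q1 q4 q2 I14) as (be2 & al2 & E2);
    [apply (det_zero_of_common_normal n); auto|].
  destruct (coplanar_comb q1 q4 q3 I14) as (be3 & al3 & E3);
    [apply (det_zero_of_common_normal n); auto|].
  assert (I12 : cross q1 q2 <> qzero) by (apply I1; simpl; auto).
  assert (I13 : cross q1 q3 <> qzero) by (apply I1; simpl; auto).
  assert (I23 : cross q2 q3 <> qzero) by (apply I2; simpl; auto).
  assert (I24 : cross q2 q4 <> qzero) by (apply I2; simpl; auto).
  assert (I34 : cross q3 q4 <> qzero) by (apply I3; simpl; auto).
  (* Independence of the four forms makes the three nodes 0, [al2 / be2], [al3 / be3] finite and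
     distinct. *)
  assert (B2 : be2 <> 0).
  { intros ->. apply I24. rewrite E2. clear. destruct q1 as [[? ?] ?], q4 as [[? ?] ?]. qsolve. apply triple_eq; ring. }
  assert (B3 : be3 <> 0).
  { intros ->. apply I34. rewrite E3. clear. destruct q1 as [[? ?] ?], q4 as [[? ?] ?]. qsolve. apply triple_eq; ring. }
  assert (A2 : al2 <> 0).
  { intros ->. apply I12. rewrite E2. clear. destruct q1 as [[? ?] ?], q4 as [[? ?] ?]. qsolve. apply triple_eq; ring. }
  assert (A3 : al3 <> 0).
  { intros ->. apply I13. rewrite E3. clear. destruct q1 as [[? ?] ?], q4 as [[? ?] ?]. qsolve. apply triple_eq; ring. }
  assert (A23 : al2 / be2 <> al3 / be3).
  { intros C. apply I23. assert (Ea : al2 = al3 / be3 * be2) by (rewrite <- C; field; auto).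
    rewrite E2, E3, Ea. clear - B3. destruct q1 as [[? ?] ?], q4 as [[? ?] ?]. qsolve. apply triple_eq; field; auto. }
  assert (Hpow : forall b, b <> 0 -> 0 < b ^ 4).
  { intros b Hb. replace (b ^ 4) with ((b ^ 2) ^ 2) by ring. apply pow2_pos, pow_nonzero; auto. }
  destruct (gauss_two_nodes 1 (be2 ^ 4) (be3 ^ 4) 0 (al2 / be2) (al3 / be3))
    as (A & B & C & y1 & y2 & HA & HB & HC & HG); auto; try lra.
  { unfold Rdiv. intros C0. symmetry in C0. apply Rmult_integral in C0 as [C0|C0]; auto.
    apply (Rinv_neq_0_compat be2); auto. }
  { unfold Rdiv. intros C0. symmetry in C0. apply Rmult_integral in C0 as [C0|C0]; auto.
    apply (Rinv_neq_0_compat be3); auto. }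
  exists [qscale (root4 A) (qcomb y1 1 0 q4 q1 q1); qscale (root4 B) (qcomb y2 1 0 q4 q1 q1);
     qscale (root4 (1 + C)) q4].
  split; [reflexivity|split].
  - assert (Hlin : forall t x y, dot n (qscale t (qcomb x y 0 q4 q1 q1)) = 0).
    { intros. transitivity (t * (x * dot n q4 + y * dot n q1)); [|rewrite D4, D1; ring].
      destruct n as [[? ?] ?], q1 as [[? ?] ?], q4 as [[? ?] ?]. qsolve. ring. }
    intros q [<-|[<-|[<-|[]]]]; auto.
    transitivity (root4 (1 + C) * dot n q4); [|rewrite D4; ring].
    destruct n as [[? ?] ?], q4 as [[? ?] ?]. qsolve. ring.
  - intros x y. rewrite !sum_fourth_lsum, !lsum_cons.
    change (lsum (fun q => qeval q x y ^ 4) []) with 0.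
    rewrite !qeval_scale, !(Rpow_mult_distr (root4 _)), !root4_pow; auto; [|lra].
    assert (Hq : forall s t r, qeval (qcomb s t 0 q4 q1 r) x y = s * qeval q4 x y + t * qeval q1 x y).
    { intros s t r. destruct q1 as [[? ?] ?], q4 as [[? ?] ?], r as [[? ?] ?]. unfold qeval. qsolve. ring. }
    assert (Hq' : forall s t r, qeval (qcomb s t 0 q1 q4 r) x y = s * qeval q1 x y + t * qeval q4 x y).
    { intros s t r. destruct q1 as [[? ?] ?], q4 as [[? ?] ?], r as [[? ?] ?]. unfold qeval. qsolve. ring. }
    rewrite E2, E3, !Hq, !Hq'. set (U := qeval q4 x y). set (V := qeval q1 x y).
    specialize (HG U V).
    transitivity (1 * (0 * U + V) ^ 4 + be2 ^ 4 * (al2 / be2 * U + V) ^ 4 + be3 ^ 4 * (al3 / be3 * U + V) ^ 4 + U ^ 4).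
    + field; auto.
    + rewrite HG. ring.
Qed.

(** Either two forms merge, or the certificate vanishes on a plane containing all the forms but at
    most one. Four forms in the plane become three that remain in it, hence remain zeros, so the
    reduction can be iterated. *)
Lemma zeros_five_to_four lam l :
  psd_certificate lam -> length l = 5%nat -> (forall q, In q l -> certificate lam q = 0) ->
  exists l', length l' = 4%nat /\ (forall q, In q l' -> certificate lam q = 0) /\ same_sum l l'.
Proof.
  intros Hp Hlen Hz.
  destruct (classic (pairwise_indep l)) as [Hi|Hi].
  2: { destruct (merge_dependent (fun q => certificate lam q = 0) l) as (l' & Hl & H1 & H2); auto.
       - intros t q Hq. rewrite certificate_homog4, Hq. ring.
       - exists l'. split; [lia|auto]. }
  assert (Hpl : exists n, n <> qzero /\ forall r, dot n r = 0 -> certificate lam r = 0).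
  { destruct l as [|q1 [|q2 [|q3 [|q4 [|q5 [|]]]]]]; try discriminate.
    apply (five_zeros_plane lam q1 q2 q3 q4 q5); auto. }
  destruct Hpl as (n & Hn & Hpl).
  assert (Hsplit : exists q l4, Permutation (q :: l4) l /\ forall r, In r l4 -> dot n r = 0).
  { destruct (classic (exists q, In q l /\ dot n q <> 0)) as [(q & Hq & Nq)|Hno].
    - destruct (in_permutation_cons _ _ Hq) as [l4 Hl4]. exists q, l4. split; auto.
      intros r Hr. destruct (Req_dec (dot n r) 0) as [|Nr]; auto. exfalso.
      destruct (in_permutation_cons _ _ Hr) as [l3 Hl3].
      apply (Hi q r l3); [rewrite Hl3; auto|].
      apply (zeros_off_plane lam n); auto.
      apply Hz, (Permutation_in _ Hl4). simpl; auto.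
    - destruct l as [|q l4]; [discriminate|]. exists q, l4. split; auto.
      intros r Hr. destruct (Req_dec (dot n r) 0) as [|Nr]; auto.
      exfalso. apply Hno. exists r. simpl; auto. }
  destruct Hsplit as (q & l4 & Hperm & Hin).
  assert (Hl4 : length l4 = 4%nat) by (apply Permutation_length in Hperm; simpl in Hperm; lia).
  destruct l4 as [|q1 [|q2 [|q3 [|q4 [|]]]]]; try discriminate.
  destruct (planar_four_to_three n q1 q2 q3 q4) as (l3 & Hl3 & Hin3 & Hs); auto.
  exists (q :: l3). split; [simpl; lia|split].
  - intros r [<-|Hr]; auto. apply Hz, (Permutation_in _ Hperm). simpl; auto.
  - eapply same_sum_trans; [apply same_sum_perm; symmetry; apply Hperm|].
    apply same_sum_cons; auto.
Qed.

Lemma zeros_to_four lam l :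
  psd_certificate lam -> (forall q, In q l -> certificate lam q = 0) ->
  exists l', (length l' <= 4)%nat /\ same_sum l l'.
Proof.
  intros Hp. remember (length l) as k eqn:Hk. revert l Hk.
  induction k as [|k IH]; intros l Hk Hz.
  - exists l. split; [lia|intros x y; reflexivity].
  - destruct (le_lt_dec (length l) 4) as [Hle|Hlt].
    + exists l. split; [auto|intros x y; reflexivity].
    + destruct (zeros_five_to_four lam (firstn 5 l)) as (l4 & H4 & Hz4 & Hs4); auto.
      * rewrite length_firstn. lia.
      * intros q Hq. apply Hz. rewrite <- (firstn_skipn 5 l). apply in_or_app. auto.
      * destruct (IH (l4 ++ skipn 5 l)) as (l' & Hl' & Hs').
        -- rewrite length_app, length_skipn. lia.
        -- intros q Hq. apply in_app_or in Hq as [Hq|Hq]; auto.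
           apply Hz. rewrite <- (firstn_skipn 5 l). apply in_or_app. auto.
        -- exists l'. split; auto. eapply same_sum_trans; [|apply Hs'].
           intros x y. rewrite <- (firstn_skipn 5 l) at 1. rewrite !sum_fourth_lsum, !lsum_app.
           rewrite <- !sum_fourth_lsum, Hs4. reflexivity.
Qed.

(** * The penalised distance *)

Definition moment (z : R) (l : list quad_form) : R := lsum (fun q => qval z q ^ 4) l.

Definition disc_sum (l : list quad_form) : R := lsum (fun q => qdisc q ^ 2) l.

Definition energy (s : R) (f : R -> R) (l : list quad_form) : R :=
  lsum (fun z => (moment z l - f z) ^ 2) nodes - s * disc_sum l.

Definition total (l : list quad_form) : R := lsum (fun z => moment z l) nodes.

Lemma octic_coefficients l : exists c0 c1 c2 c3 c4 c5 c6 c7 c8, forall x y,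
  sum_fourth l x y = c0 * x ^ 8 + c1 * x ^ 7 * y + c2 * x ^ 6 * y ^ 2 + c3 * x ^ 5 * y ^ 3
    + c4 * x ^ 4 * y ^ 4 + c5 * x ^ 3 * y ^ 5 + c6 * x ^ 2 * y ^ 6 + c7 * x * y ^ 7 + c8 * y ^ 8.
Proof.
  induction l as [|[[a b] c] l (c0 & c1 & c2 & c3 & c4 & c5 & c6 & c7 & c8 & IH)].
  - exists 0, 0, 0, 0, 0, 0, 0, 0, 0. intros. simpl. ring.
  - exists (c0 + a ^ 4), (c1 + 4 * a ^ 3 * b), (c2 + (4 * a ^ 3 * c + 6 * a ^ 2 * b ^ 2)),
      (c3 + (12 * a ^ 2 * b * c + 4 * a * b ^ 3)),
      (c4 + (6 * a ^ 2 * c ^ 2 + 12 * a * b ^ 2 * c + b ^ 4)),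
      (c5 + (12 * a * b * c ^ 2 + 4 * b ^ 3 * c)),
      (c6 + (4 * a * c ^ 3 + 6 * b ^ 2 * c ^ 2)), (c7 + 4 * b * c ^ 3), (c8 + c ^ 4).
    intros x y. rewrite sum_fourth_lsum, lsum_cons, <- sum_fourth_lsum, IH. unfold qeval. ring.
Qed.

(** Nine values at distinct points determine the nine coefficients of an octic; [lra] inverts the
    Vandermonde system. *)
Lemma same_sum_of_moments l l' :
  (forall z, In z nodes -> moment z l = moment z l') -> same_sum l l'.
Proof.
  intros H.
  destruct (octic_coefficients l) as (c0 & c1 & c2 & c3 & c4 & c5 & c6 & c7 & c8 & Hc).
  destruct (octic_coefficients l') as (d0 & d1 & d2 & d3 & d4 & d5 & d6 & d7 & d8 & Hd).
  assert (E : forall z, In z nodes -> sum_fourth l 1 z = sum_fourth l' 1 z) by apply H.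
  unfold nodes in E. simpl in E.
  pose proof (E (-4) ltac:(tauto)) as E1. pose proof (E (-3) ltac:(tauto)) as E2.
  pose proof (E (-2) ltac:(tauto)) as E3. pose proof (E (-1) ltac:(tauto)) as E4.
  pose proof (E 0 ltac:(tauto)) as E5. pose proof (E 1 ltac:(tauto)) as E6.
  pose proof (E 2 ltac:(tauto)) as E7. pose proof (E 3 ltac:(tauto)) as E8.
  pose proof (E 4 ltac:(tauto)) as E9. clear E.
  rewrite Hc, Hd in E1, E2, E3, E4, E5, E6, E7, E8, E9.
  intros x y. rewrite Hc, Hd.
  assert (F0 : c0 = d0) by lra. assert (F1 : c1 = d1) by lra. assert (F2 : c2 = d2) by lra.
  assert (F3 : c3 = d3) by lra. assert (F4 : c4 = d4) by lra. assert (F5 : c5 = d5) by lra.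
  assert (F6 : c6 = d6) by lra. assert (F7 : c7 = d7) by lra. assert (F8 : c8 = d8) by lra.
  subst. reflexivity.
Qed.

Lemma pow4_nonneg x : 0 <= x ^ 4.
Proof. replace (x ^ 4) with ((x ^ 2) ^ 2) by ring. apply pow2_ge_0. Qed.

Lemma moment_nonneg z l : 0 <= moment z l.
Proof. apply lsum_nonneg. intros. apply pow4_nonneg. Qed.

Lemma total_nonneg l : 0 <= total l.
Proof. apply lsum_nonneg. intros. apply moment_nonneg. Qed.

Lemma qval_le_total z q l : In z nodes -> In q l -> qval z q ^ 4 <= total l.
Proof.
  intros Hz Hq. apply Rle_trans with (moment z l).
  - apply (lsum_ge_term (fun q => qval z q ^ 4)); auto. intros. apply pow4_nonneg.
  - apply (lsum_ge_term (fun z => moment z l)); auto. intros. apply moment_nonneg.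
Qed.

Lemma disc_sqr_le q : qdisc q ^ 2 <= 192 * lsum (fun z => qval z q ^ 4) nodes.
Proof.
  apply Rle_trans with (192 * (qval (-1) q ^ 4 + qval 0 q ^ 4 + qval 1 q ^ 4)).
  - destruct q as [[a b] c].
    set (u := qval 1 (a, b, c)). set (v := qval (-1) (a, b, c)). set (w := qval 0 (a, b, c)).
    assert (E : qdisc (a, b, c) = (u - v) ^ 2 / 4 - 2 * w * (u + v) + 4 * w ^ 2)
      by (unfold qdisc, u, v, w, qval, qeval; field).
    rewrite E. clearbody u v w. clear E.
    (* The discriminant is bounded by [T] in absolute value. Since (p + q + r)^2 is at most 3 (p^2 +
       q^2 + r^2), the final constant is 192 = 8^2 * 3. *)
    set (T := 8 * (u ^ 2 + v ^ 2 + w ^ 2)).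
    assert (H1 : (u - v) ^ 2 / 4 - 2 * w * (u + v) + 4 * w ^ 2 <= T).
    { unfold T. pose proof (pow2_ge_0 (w + u)). pose proof (pow2_ge_0 (w + v)).
      pose proof (pow2_ge_0 (u + v)). pose proof (pow2_ge_0 u). pose proof (pow2_ge_0 v). pose proof (pow2_ge_0 w). lra. }
    assert (H2 : - T <= (u - v) ^ 2 / 4 - 2 * w * (u + v) + 4 * w ^ 2).
    { unfold T. pose proof (pow2_ge_0 (w - u)). pose proof (pow2_ge_0 (w - v)).
      pose proof (pow2_ge_0 (u - v)). pose proof (pow2_ge_0 u). pose proof (pow2_ge_0 v). pose proof (pow2_ge_0 w). lra. }
    apply Rle_trans with (T ^ 2); [apply pow_maj_Rabs, Rabs_le; lra|].
    unfold T. pose proof (pow2_ge_0 (u ^ 2 - v ^ 2)). pose proof (pow2_ge_0 (u ^ 2 - w ^ 2)).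
    pose proof (pow2_ge_0 (v ^ 2 - w ^ 2)). lra.
  - apply Rmult_le_compat_l; [lra|]. unfold nodes, lsum; simpl fold_right.
    pose proof (pow4_nonneg (qval (-4) q)). pose proof (pow4_nonneg (qval (-3) q)).
    pose proof (pow4_nonneg (qval (-2) q)). pose proof (pow4_nonneg (qval 2 q)).
    pose proof (pow4_nonneg (qval 3 q)). pose proof (pow4_nonneg (qval 4 q)). lra.
Qed.

Lemma disc_sum_le l : disc_sum l <= 192 * total l.
Proof.
  unfold total, moment. rewrite lsum_swap, <- lsum_scal.
  apply lsum_le. intros. apply disc_sqr_le.
Qed.

Lemma disc_sum_nonneg l : 0 <= disc_sum l.
Proof. apply lsum_nonneg. intros. apply pow2_ge_0. Qed.

(** The constant from completing the square in (m - f)^2 - 193 m. Here 193 = 192 + 1: the 192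
    absorbs the discriminant term, and one copy of [total] remains to give coercivity, uniformly for
    s between 0 and 1. *)
Definition energy_shift (f : R -> R) : R :=
  lsum (fun z => (2 * f z + 193) ^ 2 / 4 - f z ^ 2) nodes.

Lemma energy_lower s f l : 0 <= s <= 1 -> total l <= energy s f l + energy_shift f.
Proof.
  intros Hs.
  assert (H1 : s * disc_sum l <= 192 * total l).
  { pose proof (disc_sum_le l). pose proof (disc_sum_nonneg l). nra. }
  assert (H2 : 193 * total l <= lsum (fun z => (moment z l - f z) ^ 2) nodes + energy_shift f).
  { unfold total, energy_shift. rewrite <- lsum_scal, <- lsum_plus. apply lsum_le.
    intros z _. pose proof (pow2_ge_0 (moment z l - (2 * f z + 193) / 2)). lra. }
  unfold energy. lra.
Qed.

(** * Existence of minimisers *)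

(** Lists of length [M] are read off from 3M real coordinates, in three blocks of [M], one for each
    coefficient. *)
Definition decode (M : nat) (x : nat -> R) : list quad_form :=
  map (fun i => (x i, x (M + i)%nat, x (2 * M + i)%nat)) (seq 0 M).

Lemma map_nth_seq_eq {A} (d : A) l : map (fun i => nth i l d) (seq 0 (length l)) = l.
Proof.
  induction l as [|a l IH]; auto. simpl. f_equal.
  rewrite <- seq_shift, map_map. auto.
Qed.

Lemma decode_surj l : exists x, decode (length l) x = l.
Proof.
  set (M := length l).
  exists (fun k => if lt_dec k M then fst (fst (nth k l qzero))
                   else if lt_dec k (2 * M) then snd (fst (nth (k - M) l qzero))
                   else snd (nth (k - 2 * M) l qzero)).
  transitivity (map (fun i => nth i l qzero) (seq 0 M)); [|apply map_nth_seq_eq].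
  unfold decode.
  apply map_ext_in. intros i Hi. apply in_seq in Hi.
  destruct (lt_dec i M); [|lia].
  destruct (lt_dec (M + i) M); [lia|].
  destruct (lt_dec (M + i) (2 * M)); [|lia].
  destruct (lt_dec (2 * M + i) M); [lia|].
  destruct (lt_dec (2 * M + i) (2 * M)); [lia|].
  replace (M + i - M)%nat with i by lia. replace (2 * M + i - 2 * M)%nat with i by lia.
  destruct (nth i l qzero) as [[a b] c]. reflexivity.
Qed.

Lemma length_decode M x : length (decode M x) = M.
Proof. unfold decode. rewrite length_map, length_seq. reflexivity. Qed.

Lemma cv_const c : Un_cv (fun _ => c) c.
Proof. intros eps He. exists 0%nat. intros. rewrite Rdist_eq. auto. Qed.

Lemma cv_pow u l k : Un_cv u l -> Un_cv (fun n => u n ^ k) (l ^ k).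
Proof.
  intros H. induction k as [|k IH]; simpl.
  - apply cv_const.
  - apply CV_mult; auto.
Qed.

Lemma cv_lsum {A} (phi : nat -> A -> R) (psi : A -> R) l :
  (forall a, In a l -> Un_cv (fun n => phi n a) (psi a)) ->
  Un_cv (fun n => lsum (phi n) l) (lsum psi l).
Proof.
  induction l as [|a l IH]; simpl; intros H.
  - apply cv_const.
  - apply (CV_plus (fun n => phi n a) (fun n => lsum (phi n) l)); auto.
Qed.

Lemma energy_continuous s f M u y :
  (forall i, (i < 3 * M)%nat -> Un_cv (fun n => u n i) (y i)) ->
  Un_cv (fun n => energy s f (decode M (u n))) (energy s f (decode M y)).
Proof.
  intros H. unfold energy.
  apply (CV_minus (fun n => lsum (fun z => (moment z (decode M (u n)) - f z) ^ 2) nodes)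
    (fun n => s * disc_sum (decode M (u n)))).
  - apply cv_lsum. intros z _. apply cv_pow.
    apply (CV_minus (fun n => moment z (decode M (u n))) (fun _ => f z)); [|apply cv_const].
    unfold moment, decode. rewrite lsum_map.
    apply Un_cv_ext with (fun n => lsum (fun i => qval z (u n i, u n (M + i)%nat, u n (2 * M + i)%nat) ^ 4) (seq 0 M)).
    { intros n. rewrite lsum_map. reflexivity. }
    apply cv_lsum. intros i Hi. apply in_seq in Hi. apply cv_pow. unfold qval, qeval.
    apply (CV_plus (fun n => u n i * 1 ^ 2 + u n (M + i)%nat * 1 * z)).
    + apply (CV_plus (fun n => u n i * 1 ^ 2)).
      * apply (CV_mult (fun n => u n i)); [apply H; lia|apply cv_const].
      * apply (CV_mult (fun n => u n (M + i)%nat * 1)); [|apply cv_const].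
        apply (CV_mult (fun n => u n (M + i)%nat)); [apply H; lia|apply cv_const].
    + apply (CV_mult (fun n => u n (2 * M + i)%nat)); [apply H; lia|apply cv_const].
  - apply (CV_mult (fun _ => s)); [apply cv_const|].
    unfold disc_sum, decode. rewrite lsum_map.
    apply Un_cv_ext with (fun n => lsum (fun i => qdisc (u n i, u n (M + i)%nat, u n (2 * M + i)%nat) ^ 2) (seq 0 M)).
    { intros n. rewrite lsum_map. reflexivity. }
    apply cv_lsum. intros i Hi. apply in_seq in Hi. apply cv_pow. unfold qdisc.
    apply (CV_minus (fun n => u n (M + i)%nat ^ 2)).
    + apply cv_pow, H. lia.
    + apply (CV_mult (fun n => 4 * u n i)); [|apply H; lia].
      apply (CV_mult (fun _ => 4)); [apply cv_const|apply H; lia].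
Qed.

Lemma bound_of_pow4_le v E : 0 <= E -> v ^ 4 <= E -> - (1 + E) <= v <= 1 + E.
Proof.
  intros HE H.
  assert (Hr : Rabs v <= 1 + E); [|unfold Rabs in Hr; destruct Rcase_abs; lra].
  apply Rnot_lt_le. intros Hlt.
  assert (E4 : Rabs v ^ 4 = v ^ 4).
  { rewrite RPow_abs. apply Rabs_right. apply Rle_ge, pow4_nonneg. }
  rewrite <- E4 in H. set (r := Rabs v) in *.
  assert (1 <= r ^ 3) by (apply pow_R1_Rle; lra).
  assert (r <= r ^ 4); [|lra].
  replace (r ^ 4) with (r * r ^ 3) by ring. nra.
Qed.

Lemma energy_min s f M : 0 <= s <= 1 ->
  exists l, length l = M /\ forall l', length l' = M -> energy s f l <= energy s f l'.
Proof.
  intros Hs.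
  (* Bounds [total] on the sublevel set considered in [coercive_min], whence the summand 1. *)
  set (E := Rmax 0 (energy s f (decode M (fun _ => 0)) + 1 + energy_shift f)).
  assert (HE : 0 <= E) by apply Rmax_l.
  destruct (coercive_min (fun x => energy s f (decode M x)) (3 * M) (- energy_shift f) (2 * (1 + E)))
    as [y Hy].
  - intros. apply energy_continuous. auto.
  - intros x. pose proof (energy_lower s f (decode M x) Hs). pose proof (total_nonneg (decode M x)). lra.
  - intros x Hx k Hk.
    assert (Ht : total (decode M x) <= E).
    { pose proof (energy_lower s f (decode M x) Hs).
      eapply Rle_trans; [|apply Rmax_r]. lra. }
    assert (Hq : forall q z, In q (decode M x) -> In z nodes -> - (1 + E) <= qval z q <= 1 + E).
    { intros q z Hq Hz. apply bound_of_pow4_le; auto.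
      pose proof (qval_le_total z q _ Hz Hq). lra. }
    assert (Hc : forall i, (i < M)%nat -> Rabs (x i) <= 2 * (1 + E) /\ Rabs (x (M + i)%nat) <= 2 * (1 + E)
       /\ Rabs (x (2 * M + i)%nat) <= 2 * (1 + E)).
    { intros i Hi.
      assert (Hin : In (x i, x (M + i)%nat, x (2 * M + i)%nat) (decode M x)).
      { apply (in_map (fun i => (x i, x (M + i)%nat, x (2 * M + i)%nat))). apply in_seq. lia. }
      (* The values at 0, 1 and -1 determine the three coefficients and bound each by 2 (1 + E). *)
      assert (V0 := Hq _ 0 Hin ltac:(unfold nodes; simpl; tauto)).
      assert (V1 := Hq _ 1 Hin ltac:(unfold nodes; simpl; tauto)).
      assert (V2 := Hq _ (-1) Hin ltac:(unfold nodes; simpl; tauto)).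
      unfold qval, qeval in V0, V1, V2.
      repeat split; apply Rabs_le; lra. }
    destruct (lt_dec k M) as [H1|H1]; [apply (Hc k H1)|].
    destruct (lt_dec k (2 * M)) as [H2|H2].
    + destruct (Hc (k - M)%nat) as (_ & HB & _); [lia|]. replace (M + (k - M))%nat with k in HB by lia. auto.
    + destruct (Hc (k - 2 * M)%nat) as (_ & _ & HB); [lia|].
      replace (2 * M + (k - 2 * M))%nat with k in HB by lia. auto.
  - exists (decode M y). split; [apply length_decode|].
    intros l' Hl'. destruct (decode_surj l') as [x <-]. rewrite Hl'. apply Hy.
Qed.

(** * First-order conditions at a minimiser *)

Lemma first_order_nonneg a b : (forall t, 0 <= t <= 1 -> 0 <= a * t + b * t ^ 2) -> 0 <= a.
Proof.
  intros H. apply Rnot_lt_le. intros Ha.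
  pose proof (Rabs_pos b) as Hb.
  set (d := Rabs b + 1 - a). assert (Hd : 0 < d) by (unfold d; lra).
  set (t := - a / d).
  assert (Et : t * d = - a) by (unfold t; field; lra).
  assert (Ht : 0 < t) by (apply Rmult_lt_reg_r with d; lra).
  assert (Ht1 : t <= 1) by (apply Rmult_le_reg_r with d; unfold d in *; lra).
  specialize (H t ltac:(lra)).
  assert (b * t <= Rabs b * t) by (apply Rmult_le_compat_r; [lra|apply Rle_abs]).
  assert (0 < t * (1 - a)) by (apply Rmult_lt_0_compat; lra).
  assert (a + b * t < 0) by (unfold d in Et; lra).
  nra.
Qed.

Lemma moment_homog4 z : homog4 (fun q => qval z q ^ 4).
Proof. intros t q. unfold qval. rewrite qeval_scale. ring. Qed.

Lemma disc_homog4 : homog4 (fun q => qdisc q ^ 2).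
Proof. intros t [[a b] c]. unfold qdisc, qscale. ring. Qed.

Lemma lsum_qscale phi t l : homog4 phi -> lsum phi (map (qscale t) l) = t ^ 4 * lsum phi l.
Proof.
  intros H. rewrite lsum_map, <- lsum_scal. apply lsum_ext. intros; apply H.
Qed.

(** The energy depends on ten homogeneous sums, nine values and the discriminant term, so one of at
    least eleven forms can be removed. Minimality among lists of a fixed length at least ten
    therefore also holds against adding a form. *)
Lemma energy_add_reduce s f l q : (10 <= length l)%nat ->
  exists l', length l' = length l /\ energy s f l' = energy s f (q :: l).
Proof.
  intros Hl.
  destruct (caratheodory_step ((fun q => qdisc q ^ 2) :: map (fun z q => qval z q ^ 4) nodes) (q :: l))
    as (l' & Hlen & Hsum).
  - intros phi [<-|Hphi]; [apply disc_homog4|].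
    apply in_map_iff in Hphi as (z & <- & _). apply moment_homog4.
  - simpl. lia.
  - exists l'. split; [simpl in Hlen; lia|].
    unfold energy, disc_sum. rewrite (Hsum (fun q => qdisc q ^ 2)) by (now left).
    f_equal. apply lsum_ext. intros z Hz. unfold moment.
    rewrite (Hsum (fun q => qval z q ^ 4)); auto.
    right. apply (in_map (fun z q => qval z q ^ 4)). auto.
Qed.

(** Adding a small multiple of [q] changes the energy at rate s P(q), so P is nonnegative. Rescaling
    the whole list in both directions shows that P sums to zero over [l], so every term vanishes. *)
Lemma minimiser_certificate s f l :
  0 < s -> (10 <= length l)%nat ->
  (forall l', length l' = length l -> energy s f l <= energy s f l') ->
  exists lam, psd_certificate lam /\ forall q, In q l -> certificate lam q = 0.
Proof.
  intros Hs Hlen Hmin.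
  (* The gradient of the squared distance at [l], divided by [s]. *)
  set (lam := fun z => 2 * (moment z l - f z) / s).
  assert (Hder : forall q, s * certificate lam q
    = lsum (fun z => 2 * (moment z l - f z) * qval z q ^ 4) nodes - s * qdisc q ^ 2).
  { intros q. unfold certificate. rewrite Rmult_minus_distr_l, <- lsum_scal. f_equal.
    apply lsum_ext. intros z _. unfold lam. field. lra. }
  assert (Hpsd : psd_certificate lam).
  { intros q. apply Rmult_le_reg_l with s; auto. rewrite Rmult_0_r, Hder.
    apply first_order_nonneg with (b := lsum (fun z => (qval z q ^ 4) ^ 2) nodes).
    intros t Ht.
    destruct (energy_add_reduce s f l (qscale (root4 t) q) Hlen) as (l' & Hl' & El').
    specialize (Hmin l' Hl'). rewrite El' in Hmin. unfold energy, disc_sum in Hmin.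
    rewrite lsum_cons, (disc_homog4 (root4 t) q), root4_pow in Hmin by lra.
    rewrite (lsum_ext (fun z => (moment z (qscale (root4 t) q :: l) - f z) ^ 2)
      (fun z => (moment z l - f z) ^ 2
        + (t * (2 * (moment z l - f z) * qval z q ^ 4) + t ^ 2 * (qval z q ^ 4) ^ 2))) in Hmin.
    - rewrite !lsum_plus, !lsum_scal in Hmin. lra.
    - intros z _. unfold moment at 1. rewrite lsum_cons, (moment_homog4 z (root4 t) q), root4_pow by lra.
      fold (moment z l). ring. }
  exists lam. split; auto.
  (* [a] is the derivative of the energy when all fourth powers in [l] are multiplied by 1 + u. *)
  set (a := lsum (fun z => 2 * (moment z l - f z) * moment z l) nodes - s * disc_sum l).
  assert (Ea : s * lsum (certificate lam) l = a).
  { rewrite <- lsum_scal. rewrite (lsum_ext _ _ l (fun q _ => Hder q)).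
    unfold a, disc_sum, moment at 3.
    rewrite (lsum_ext _ (fun q => lsum (fun z => 2 * (moment z l - f z) * qval z q ^ 4) nodes
       + (- s) * qdisc q ^ 2)) by (intros; ring).
    rewrite lsum_plus, lsum_scal, lsum_swap.
    rewrite (lsum_ext _ (fun z => 2 * (moment z l - f z) * lsum (fun q => qval z q ^ 4) l) nodes)
      by (intros; apply lsum_scal). ring. }
  assert (Hexp : forall u, -1 <= u -> 0 <= a * u + lsum (fun z => moment z l ^ 2) nodes * u ^ 2).
  { intros u Hu.
    specialize (Hmin (map (qscale (root4 (1 + u))) l) ltac:(apply length_map)).
    unfold energy, disc_sum in Hmin.
    rewrite (lsum_qscale _ _ _ disc_homog4), root4_pow in Hmin by lra.
    rewrite (lsum_ext (fun z => (moment z (map (qscale (root4 (1 + u))) l) - f z) ^ 2)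
      (fun z => (moment z l - f z) ^ 2
       + (u * (2 * (moment z l - f z) * moment z l) + u ^ 2 * moment z l ^ 2))) in Hmin.
    - rewrite !lsum_plus, !lsum_scal in Hmin. unfold a, disc_sum. lra.
    - intros z _. unfold moment at 1. rewrite (lsum_qscale _ _ _ (moment_homog4 z)), root4_pow by lra.
      fold (moment z l). ring. }
  assert (A1 : 0 <= a).
  { apply first_order_nonneg with (lsum (fun z => moment z l ^ 2) nodes). intros t Ht. apply Hexp. lra. }
  assert (A2 : 0 <= - a).
  { apply first_order_nonneg with (lsum (fun z => moment z l ^ 2) nodes). intros t Ht.
    specialize (Hexp (- t) ltac:(lra)). lra. }
  apply lsum_zero_terms.
  - intros; apply Hpsd.
  - apply Rmult_eq_reg_l with s; lra.
Qed.

Lemma lsum_pad (phi : quad_form -> R) l k : homog4 phi ->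
  lsum phi (l ++ repeat qzero k) = lsum phi l.
Proof.
  intros H. rewrite lsum_app.
  assert (Z : phi qzero = 0).
  { rewrite <- (qscale_0 qzero), H. ring. }
  induction k as [|k IH]; simpl; lra.
Qed.

Lemma energy_pad s f l k : energy s f (l ++ repeat qzero k) = energy s f l.
Proof.
  unfold energy, disc_sum. rewrite (lsum_pad _ _ _ disc_homog4). f_equal.
  apply lsum_ext. intros z _. unfold moment. rewrite (lsum_pad _ _ _ (moment_homog4 z)). reflexivity.
Qed.

Lemma same_sum_moment l l' z : same_sum l l' -> moment z l = moment z l'.
Proof. intros H. apply (H 1 z). Qed.

(** * The upper bound *)

(** Closedness enters as an attained minimum: the distance from [f] to sums of four fourth powers
    has a minimiser [m]. If the minimum [d] is positive, a single small [s] already gives four forms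
    closer than [d]. *)
Lemma ten_to_four l : (length l <= 10)%nat -> exists l', (length l' <= 4)%nat /\ same_sum l l'.
Proof.
  intros Hl.
  set (f := fun z => moment z l).
  destruct (energy_min 0 f 4) as (m & Hm & Hmin); [lra|].
  assert (E0 : forall k, energy 0 f k = lsum (fun z => (moment z k - f z) ^ 2) nodes)
    by (intros; unfold energy; ring).
  assert (Hd0 : 0 <= energy 0 f m).
  { rewrite E0. apply lsum_nonneg. intros. apply pow2_ge_0. }
  destruct (Req_dec (energy 0 f m) 0) as [Hz|Hnz].
  { exists m. split; [lia|]. apply same_sum_of_moments. intros z Hin.
    rewrite E0 in Hz.
    assert (Z := lsum_zero_terms _ nodes (fun z _ => pow2_ge_0 (moment z m - f z)) Hz z Hin).
    simpl in Z. rewrite Rmult_1_r in Z. apply Rmult_integral in Z. unfold f in Z.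
    destruct Z; lra. }
  exfalso.
  set (d := energy 0 f m) in *.
  set (K := 192 * energy_shift f).
  set (B := Rmax 0 K).
  assert (HB : 0 <= B) by apply Rmax_l. assert (HK : K <= B) by apply Rmax_r.
  (* With this [s] the penalty at the minimiser [l1] is at most s B, which is less than [d]. *)
  set (s := d / (d + B + 1)).
  assert (Es : s * (d + B + 1) = d) by (unfold s; field; lra).
  assert (Hs0 : 0 < s) by (apply Rmult_lt_0_compat; [lra|apply Rinv_0_lt_compat; lra]).
  assert (Hs1 : s <= 1) by (apply Rmult_le_reg_r with (d + B + 1); lra).
  destruct (energy_min s f 10) as (l1 & Hl1 & Hmin1); [lra|].
  (* The padded list [l] has distance 0 from [f], so its energy is at most 0. *)
  assert (Hle : energy s f l1 <= 0).
  { eapply Rle_trans; [apply (Hmin1 (l ++ repeat qzero (10 - length l)))|].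
    - rewrite length_app, repeat_length. lia.
    - rewrite energy_pad. unfold energy, f.
      rewrite (lsum_ext _ (fun z => 0 * 0)) by (intros; ring). rewrite lsum_scal.
      pose proof (disc_sum_nonneg l). nra. }
  destruct (minimiser_certificate s f l1) as (lam & Hp & Hz); auto; [lia|rewrite Hl1; auto|].
  destruct (zeros_to_four lam l1 Hp Hz) as (l4 & Hl4 & Hs4).
  assert (Hge : d <= energy 0 f l4).
  { rewrite <- (energy_pad 0 f l4 (4 - length l4)). apply Hmin.
    rewrite length_app, repeat_length. lia. }
  (* The four forms have the same sum as [l1], hence the same distance from [f]. *)
  assert (Heq : energy 0 f l4 = energy 0 f l1).
  { rewrite !E0. apply lsum_ext. intros z _. rewrite (same_sum_moment _ _ z Hs4). reflexivity. }
  pose proof (energy_lower s f l1 ltac:(lra)) as Hlow.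
  pose proof (disc_sum_le l1) as Hdl.
  assert (Hfin : energy 0 f l1 = energy s f l1 + s * disc_sum l1) by (unfold energy; ring).
  assert (s * disc_sum l1 <= s * B) by (apply Rmult_le_compat_l; [lra|unfold K in *; lra]).
  assert (0 < s * (d + 1)) by (apply Rmult_lt_0_compat; lra).
  lra.
Qed.

Lemma p4_bound_4 : p4_bound 4.
Proof.
  intros f [l Hl].
  assert (H : exists l', (length l' <= 4)%nat /\ same_sum l l').
  { clear f Hl. induction l as [|q l (l' & Hl' & Hs)].
    - exists []. split; [simpl; lia|intros x y; reflexivity].
    - destruct (ten_to_four (q :: l')) as (l4 & Hl4 & Hs4); [simpl; lia|].
      exists l4. split; auto. eapply same_sum_trans; [apply same_sum_cons, Hs|auto]. }
  destruct H as (l' & Hlen & Hs). exists l'. split; auto.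
  intros x y. rewrite Hl. apply Hs.
Qed.

(** * The lower bound and the conclusion *)

Lemma not_p4_bound_2 : ~ p4_bound 2.
Proof.
  intros H.
  destruct (H (sum_fourth [(1, 0, 0); (0, 1, 0); (1, 1, 0)])) as (l & Hlen & Hl).
  { eexists. intros x y. reflexivity. }
  assert (Hpad : exists a b c a' b' c', same_sum l [(a, b, c); (a', b', c')]).
  { destruct l as [|[[a b] c] [|[[a' b'] c'] [|]]]; simpl in Hlen; try lia.
    - exists 0, 0, 0, 0, 0, 0. intros x y. unfold sum_fourth, qeval; simpl. ring.
    - exists a, b, c, 0, 0, 0. intros x y. unfold sum_fourth, qeval; simpl. ring.
    - exists a, b, c, a', b', c'. intros x y. reflexivity. }
  destruct Hpad as (a & b & c & a' & b' & c' & Hs).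
  assert (E : forall x y, sum_fourth [(1, 0, 0); (0, 1, 0); (1, 1, 0)] x y
    = sum_fourth [(a, b, c); (a', b', c')] x y).
  { intros x y. rewrite <- Hs. apply Hl. }
  unfold sum_fourth, qeval in E. simpl fold_right in E.
  assert (E01 := E 0 1).
  (* The octic vanishes at (0,1), so x divides both forms. *)
  assert (Hc : c = 0 /\ c' = 0).
  { assert (S0 : c ^ 4 + c' ^ 4 = 0) by lra.
    pose proof (pow4_nonneg c). pose proof (pow4_nonneg c').
    split; apply NNPP; intros N; apply (pow_nonzero _ 4) in N; lra. }
  destruct Hc as [-> ->].
  pose proof (E 1 0) as E0. pose proof (E 1 1) as E1. pose proof (E 1 (-1)) as E2.
  pose proof (E 1 2) as E3. pose proof (E 1 (-2)) as E4. clear E E01 Hs Hl H Hlen l.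
  (* The coefficients of x^4 + y^4 + (x+y)^4 divided by the binomials 1, 4, 6, 4, 1. *)
  assert (M0 : a ^ 4 + a' ^ 4 = 2) by lra.
  assert (M1 : a ^ 3 * b + a' ^ 3 * b' = 1) by lra.
  assert (M2 : a ^ 2 * b ^ 2 + a' ^ 2 * b' ^ 2 = 1) by lra.
  assert (M3 : a * b ^ 3 + a' * b' ^ 3 = 1) by lra.
  assert (M4 : b ^ 4 + b' ^ 4 = 2) by lra.
  clear E0 E1 E2 E3 E4.
  (* The Hankel matrix of a sum of two fourth powers of linear forms has rank at most 2, so its
     determinant vanishes; for the values 2, 1, 1, 1, 2 it equals 1. *)
  assert (Hdet : forall m0 m1 m2 m3 m4, a ^ 4 + a' ^ 4 = m0 -> a ^ 3 * b + a' ^ 3 * b' = m1 ->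
    a ^ 2 * b ^ 2 + a' ^ 2 * b' ^ 2 = m2 -> a * b ^ 3 + a' * b' ^ 3 = m3 -> b ^ 4 + b' ^ 4 = m4 ->
    m0 * (m2 * m4 - m3 ^ 2) - m1 * (m1 * m4 - m2 * m3) + m2 * (m1 * m3 - m2 ^ 2) = 0).
  { intros; subst; ring. }
  specialize (Hdet _ _ _ _ _ M0 M1 M2 M3 M4). lra.
Qed.

Lemma p4_bound_mono k k' : (k <= k')%nat -> p4_bound k -> p4_bound k'.
Proof.
  intros Hk H f Hf. destruct (H f Hf) as (l & Hl & Hr). exists l. split; [lia|auto].
Qed.

Theorem mainTheorem14 :
  exists p : nat, is_p4_2_8 p /\ (p = 3%nat \/ p = 4%nat).
Proof.
  (* Whether three fourth powers suffice is not decided; each case gives one of the two values. *)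
  destruct (classic (p4_bound 3)) as [H3|H3].
  - exists 3%nat. split; auto. split; auto.
    intros ell Hell. apply Nat.nlt_ge. intros Hlt.
    apply not_p4_bound_2, (p4_bound_mono ell); auto. lia.
  - exists 4%nat. split; auto. split; [apply p4_bound_4|].
    intros ell Hell. apply Nat.nlt_ge. intros Hlt.
    apply H3, (p4_bound_mono ell); auto. lia.
Qed.
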